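(* Let $\Gamma$ be any connected Coxeter graph. Then the centralizer of $\mathrm{KVA}[\Gamma]$ in $\mathrm{VA}[\Gamma]$ is trivial: $Z_{\mathrm{VA}[\Gamma]}(\mathrm{KVA}[\Gamma])=\{\mathrm{id}\}$.
   Context: A Coxeter matrix on a countable (finite or infinite) set $S$ is a symmetric matrix $(m_{s,t})_{s,t\in S}$ with $m_{s,s}=1$ for all $s$ and $m_{s,t}\in\{2,3,4,\dots\}\cup\{\infty\}$ for $s\neq t$. It is encoded by the Coxeter graph $\Gamma$: the simplicial graph with vertex set $S$ in which distinct $s,t$ are joined by an edge iff $m_{s,t}\ge 3$, the edge being labeled by $m_{s,t}$ when $m_{s,t}\geq 4$ (including $\infty$). The Coxeter group $\mathrm{W}[\Gamma]$ has generating set $S$ and relations $s^2=\mathrm{id}$ for all $s\in S$ and $(st)^{m_{s,t}}=\mathrm{id}$ for all $s\ne t$ with $m_{s,t}\neq\infty$. The virtual Artin group $\mathrm{VA}[\Gamma]$ is the group with generators $\{\sigma_s : s\in S\}\cup\{\tau_s : s\in S\}$ and relations: (VA1) $\cdots\sigma_s\sigma_t\sigma_s=\cdots\sigma_t\sigma_s\sigma_t$ (alternating words, both sides with $m_{s,t}$ letters, the left one ending in $\sigma_s$, the right one ending in $\sigma_t$) for all $s\ne t$ with $m_{s,t}\neq\infty$; (VA2) $\cdots\tau_s\tau_t\tau_s=\cdots\tau_t\tau_s\tau_t$ (both sides with $m_{s,t}$ letters) for all $s\neq t$ with $m_{s,t}\ne\infty$, and $\tau_s^2=\mathrm{id}$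 for all $s\in S$; (VA3) for all $s\ne t$ with $m_{s,t}\neq\infty$, $P\,\sigma_t=\sigma_r\,P$, where $P=\cdots\tau_s\tau_t\tau_s$ is the alternating word in $\tau_s,\tau_t$ with $m_{s,t}-1$ letters ending in $\tau_s$, and $r=t$ if $m_{s,t}$ is even, $r=s$ if $m_{s,t}$ is odd. $\mathrm{KVA}[\Gamma]$ is the kernel of the homomorphism $\pi_K:\mathrm{VA}[\Gamma]\to\mathrm{W}[\Gamma]$ with $\pi_K(\tau_s)=s$ and $\pi_K(\sigma_s)=\mathrm{id}$ for all $s\in S$. For a subset $E$ of a group $G$, $Z_G(E)=\{g\in G : ge=eg \text{ for all } e\in E\}$. *)

(* Defs.v *)
From HB Require Import structures.
From mathcomp Require Import all_boot.
From mathcomp Require Import boolp classical_sets.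

Set Implicit Arguments.
Unset Strict Implicit.
Unset Printing Implicit Defensive.

Import Monoid.Theory.
Local Open Scope quotient_scope.
Local Open Scope group_scope.

Section Presentation.
Variable X : choiceType.

(* A letter [(x, false)] stands for [x] and [(x, true)] for its inverse. *)
Definition gword := seq (X * bool).

Definition posword (w : seq X) : gword := [seq (x, false) | x <- w].

Variable R : gword -> gword -> Prop.

Inductive pres_eq : gword -> gword -> Prop :=
| pres_eq_refl u : pres_eq u u
| pres_eq_sym u v : pres_eq u v -> pres_eq v u
| pres_eq_trans u v w : pres_eq u v -> pres_eq v w -> pres_eq u w
| pres_eq_cat u u' v v' :
    pres_eq u u' -> pres_eq v v' -> pres_eq (u ++ v) (u' ++ v')
| pres_eq_cancel x b : pres_eq [:: (x, b); (x, ~~ b)] [::]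
| pres_eq_rel u v : R u v -> pres_eq u v.

Definition pres_eqb : rel gword := fun u v => `[< pres_eq u v >].

Lemma pres_eqb_equiv : equiv_class_of pres_eqb.
Proof.
split=> [u|u v|v u w].
- exact/asboolP/pres_eq_refl.
- by apply/idP/idP => /asboolP/pres_eq_sym/asboolP.
- by move=> /asboolP uv /asboolP vw; apply/asboolP/(pres_eq_trans uv vw).
Qed.

Canonical pres_equiv := EquivRelPack pres_eqb_equiv.

Definition pres_group := {eq_quot pres_equiv}.

HB.instance Definition _ := EqQuotient.on pres_group.
HB.instance Definition _ := Choice.on pres_group.

Lemma pres_piP (u v : gword) :
  \pi_pres_group u = \pi_pres_group v <-> pres_eq u v.
Proof.
split; first by move=> /eqP; rewrite eqmodE => /asboolP.
by move=> uv; apply/eqP; rewrite eqmodE; apply/asboolP.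
Qed.

Lemma pres_repr_pi (u : gword) : pres_eq (repr (\pi_pres_group u)) u.
Proof. by apply/pres_piP; rewrite reprK. Qed.

Definition inv_word (u : gword) : gword := rev [seq (l.1, ~~ l.2) | l <- u].

Lemma inv_wordK : involutive inv_word.
Proof.
move=> u; rewrite /inv_word map_rev revK -map_comp -[RHS]map_id.
by apply: eq_map => -[x b] /=; rewrite negbK.
Qed.

Lemma inv_word_cat u v : inv_word (u ++ v) = inv_word v ++ inv_word u.
Proof. by rewrite /inv_word map_cat rev_cat. Qed.

Lemma pres_eq_mulwV u : pres_eq (u ++ inv_word u) [::].
Proof.
elim: u => [|[x b] u IHu]; first exact: pres_eq_refl.
rewrite /inv_word /= rev_cons -cats1 -/(inv_word u).
rewrite -[_ :: _ ++ _]/([:: (x, b)] ++ (u ++ (inv_word u ++ _))) (catA u).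
apply: pres_eq_trans (pres_eq_cancel x b).
by apply: (pres_eq_cat (pres_eq_refl [:: (x, b)]));
   apply: (pres_eq_cat IHu (pres_eq_refl [:: (x, ~~ b)])).
Qed.

Lemma pres_eq_mulVw u : pres_eq (inv_word u ++ u) [::].
Proof. by rewrite -{2}(inv_wordK u); exact: pres_eq_mulwV. Qed.

Lemma pres_eq_inv u v : pres_eq u v -> pres_eq (inv_word u) (inv_word v).
Proof.
move=> uv; rewrite -[inv_word u]cats0.
apply: (@pres_eq_trans _ (inv_word u ++ (v ++ inv_word v))).
  by apply: (pres_eq_cat (pres_eq_refl _)); apply/pres_eq_sym/pres_eq_mulwV.
rewrite catA -[X in pres_eq _ X]cat0s.
apply: pres_eq_cat (pres_eq_refl _).
apply: pres_eq_trans (pres_eq_mulVw u).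
by apply: (pres_eq_cat (pres_eq_refl _)); apply: pres_eq_sym.
Qed.

Definition pres_one : pres_group := \pi_pres_group [::].
Definition pres_mul (a b : pres_group) : pres_group :=
  \pi_pres_group (repr a ++ repr b).
Definition pres_inv (a : pres_group) : pres_group :=
  \pi_pres_group (inv_word (repr a)).

Lemma pres_mul_pi u v :
  pres_mul (\pi_pres_group u) (\pi_pres_group v) = \pi_pres_group (u ++ v).
Proof.
by rewrite /pres_mul; apply/pres_piP; apply: pres_eq_cat; exact: pres_repr_pi.
Qed.

Lemma pres_inv_pi u :
  pres_inv (\pi_pres_group u) = \pi_pres_group (inv_word u).
Proof.
by rewrite /pres_inv; apply/pres_piP; apply: pres_eq_inv; exact: pres_repr_pi.
Qed.

Fact pres_mulA : associative pres_mul.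
Proof.
move=> a b c; rewrite -[a]reprK -[b]reprK -[c]reprK.
move: (repr a) (repr b) (repr c) => u v w.
rewrite (pres_mul_pi v w) (pres_mul_pi u v).
by rewrite (pres_mul_pi u (v ++ w)) (pres_mul_pi (u ++ v) w) catA.
Qed.

Fact pres_mul1 : left_id pres_one pres_mul.
Proof. by move=> a; rewrite -[a]reprK pres_mul_pi. Qed.

Fact pres_mulr1 : right_id pres_one pres_mul.
Proof. by move=> a; rewrite -[a]reprK pres_mul_pi cats0. Qed.

Fact pres_mulV : left_inverse pres_one pres_inv pres_mul.
Proof.
move=> a; rewrite -[a]reprK pres_inv_pi pres_mul_pi.
by apply/pres_piP; exact: pres_eq_mulVw.
Qed.

Fact pres_mulrV : right_inverse pres_one pres_inv pres_mul.
Proof.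
move=> a; rewrite -[a]reprK pres_inv_pi pres_mul_pi.
by apply/pres_piP; exact: pres_eq_mulwV.
Qed.

HB.instance Definition _ := isGroup.Build pres_group
  pres_mulA pres_mul1 pres_mulr1 pres_mulV pres_mulrV.

Definition pres_gen (x : X) : pres_group := \pi_pres_group [:: (x, false)].

Section Lift.
Variables (H : groupType) (f : X -> H).

Definition eval_word (u : gword) : H :=
  \prod_(l <- u) (if l.2 then (f l.1)^-1 else f l.1).

Definition pres_lift (a : pres_group) : H := eval_word (repr a).

Lemma eval_word_cat u v : eval_word (u ++ v) = eval_word u * eval_word v.
Proof. by rewrite /eval_word big_cat. Qed.

Hypothesis f_rel : forall u v, R u v -> eval_word u = eval_word v.

Lemma eval_word_eq u v : pres_eq u v -> eval_word u = eval_word v.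
Proof.
elim=> //.
- by move=> {}u {}v w _ -> _ ->.
- by move=> {}u u' {}v v' _ IHu _ IHv; rewrite !eval_word_cat IHu IHv.
- move=> x [] /=; rewrite /eval_word !big_cons !big_nil /= mulg1.
    by rewrite mulVg.
  by rewrite mulgV.
Qed.

Lemma pres_lift_pi u : pres_lift (\pi_pres_group u) = eval_word u.
Proof. by apply: eval_word_eq; exact: pres_repr_pi. Qed.

Lemma pres_liftM : {morph pres_lift : a b / a * b}.
Proof.
move=> a b; rewrite -[a]reprK -[b]reprK.
by rewrite [_ * _]pres_mul_pi !pres_lift_pi eval_word_cat.
Qed.

Lemma pres_liftF : {morph pres_lift : a b / a / b}.
Proof.
have lift1 : pres_lift 1 = 1.
  by apply: etrans (pres_lift_pi [::]) _; rewrite /eval_word big_nil.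
move=> a b; rewrite pres_liftM; congr (_ * _); apply: (mulgI (pres_lift b)).
by rewrite -pres_liftM !mulgV.
Qed.

Lemma pres_lift_gen x : pres_lift (pres_gen x) = f x.
Proof. by rewrite pres_lift_pi /eval_word big_seq1. Qed.

End Lift.

Lemma eval_word_gen u : eval_word pres_gen u = \pi_pres_group u.
Proof.
elim: u => [|[x b] u IHu]; first by rewrite /eval_word big_nil.
rewrite /eval_word big_cons -/(eval_word _ _) IHu.
rewrite -[(x, b) :: u]cat1s -pres_mul_pi.
by case: b => //=; rewrite [_^-1]pres_inv_pi.
Qed.

Lemma pres_relE u v : R u v -> eval_word pres_gen u = eval_word pres_gen v.
Proof. by move=> uv; rewrite !eval_word_gen; apply/pres_piP/pres_eq_rel. Qed.

End Presentation.

(* The entry [None] stands for the value infinity. *)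
Record coxeterMatrix (S : countType) := CoxeterMatrix {
  cox_entry :> S -> S -> option nat;
  cox_diag : forall s, cox_entry s s = Some 1%N;
  cox_sym : forall s t, cox_entry s t = cox_entry t s;
  cox_offdiag : forall s t k,
    s != t -> cox_entry s t = Some k -> (2 <= k)%N
}.

Definition cox_edge (S : countType) (m : coxeterMatrix S) : rel S :=
  fun s t => (s != t) && (if m s t is Some k then (3 <= k)%N else true).

Definition cox_connected (S : countType) (m : coxeterMatrix S) : Prop :=
  forall s t, exists2 p, path (cox_edge m) s p & last s p = t.

(* The alternating word in [x] and [y] with [n] letters, ending in [x]. *)
Fixpoint altword (X : Type) (x y : X) (n : nat) : seq X :=
  if n is k.+1 then rcons (altword y x k) x else [::].

Section EvalWords.
Variables (X : choiceType) (H : groupType) (f : X -> H).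

Lemma eval_posword_cons x w :
  eval_word f (posword (x :: w)) = f x * eval_word f (posword w).
Proof. by rewrite /eval_word big_cons. Qed.

Lemma eval_posword_rcons x w :
  eval_word f (posword (rcons w x)) = eval_word f (posword w) * f x.
Proof.
by rewrite /posword map_rcons -cats1 eval_word_cat /eval_word big_seq1.
Qed.

Lemma eval_posword_nil : eval_word f (posword [::]) = 1.
Proof. by rewrite /eval_word big_nil. Qed.

Lemma eval_posword_pow x y k :
  eval_word f (posword (flatten (nseq k [:: x; y]))) = (f x * f y) ^+ k.
Proof.
elim: k => [|k IHk]; first exact: eval_posword_nil.
by rewrite [flatten _]/= !eval_posword_cons IHk mulgA expgS.
Qed.

Lemma eval_altword1 x y k :
  f x = 1 -> f y = 1 -> eval_word f (posword (altword x y k)) = 1.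
Proof.
elim: k x y => [|k IHk] x y fx fy; first exact: eval_posword_nil.
by rewrite [altword _ _ _]/= eval_posword_rcons IHk // mul1g.
Qed.

Lemma eval_altword_comm x y k :
  f x * f x = 1 -> f y * f y = 1 -> (f x * f y) ^+ k = 1 ->
  eval_word f (posword (altword x y k)) = eval_word f (posword (altword y x k)).
Proof.
move=> fx fy fxy.
have invE z : f z * f z = 1 -> (f z)^-1 = f z.
  by move=> fz; rewrite -[LHS]mulg1 -fz mulKg.
suff key n u v : f u * f u = 1 -> f v * f v = 1 ->
    (eval_word f (posword (altword u v n)))^-1 *
      eval_word f (posword (altword v u n)) = (f u * f v) ^+ n.
  by apply/esym/(mulgI (eval_word f (posword (altword x y k)))^-1);
     rewrite key // mulVg.
elim: n u v => [|n IHn] u v fu fv.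
  by rewrite ![altword _ _ _]/= eval_posword_nil mulVg.
rewrite ![altword _ _ _.+1]/= !eval_posword_rcons invgM.
rewrite (invE u) // -mulgA (mulgA _ _ (f v)).
rewrite IHn // mulgA expgS -!mulgA; congr (_ * _).
elim: n {IHn} => [|n IHn]; first by rewrite mul1g mulg1.
by rewrite !expgS -!mulgA IHn.
Qed.

End EvalWords.

Section CoxeterGroup.
Variables (S : countType) (m : coxeterMatrix S).

Inductive coxeter_rel : gword S -> gword S -> Prop :=
| CoxSquare s : coxeter_rel (posword [:: s; s]) [::]
| CoxPower s t k : s != t -> m s t = Some k ->
    coxeter_rel (posword (flatten (nseq k [:: s; t]))) [::].

Definition coxeter_group := pres_group coxeter_rel.
HB.instance Definition _ := Group.on coxeter_group.

Definition cox_gen (s : S) : coxeter_group := pres_gen coxeter_rel s.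

End CoxeterGroup.

Section VirtualArtin.
Variables (S : countType) (m : coxeterMatrix S).

Definition va_gen : choiceType := (S + S)%type.
Definition va_sigma (s : S) : va_gen := inl s.
Definition va_tau (s : S) : va_gen := inr s.

Inductive va_rel : gword va_gen -> gword va_gen -> Prop :=
| VA1 s t k : s != t -> m s t = Some k ->
    va_rel (posword (altword (va_sigma s) (va_sigma t) k))
           (posword (altword (va_sigma t) (va_sigma s) k))
| VA2_braid s t k : s != t -> m s t = Some k ->
    va_rel (posword (altword (va_tau s) (va_tau t) k))
           (posword (altword (va_tau t) (va_tau s) k))
| VA2_square s : va_rel (posword [:: va_tau s; va_tau s]) [::]
| VA3 s t k : s != t -> m s t = Some k ->
    let P := altword (va_tau s) (va_tau t) k.-1 in
    let r := if odd k then s else t in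
    va_rel (posword (rcons P (va_sigma t))) (posword (va_sigma r :: P)).

Definition virtual_artin := pres_group va_rel.
HB.instance Definition _ := Group.on virtual_artin.

Definition sigma (s : S) : virtual_artin := pres_gen va_rel (va_sigma s).
Definition tau (s : S) : virtual_artin := pres_gen va_rel (va_tau s).

Definition piK_gen (x : va_gen) : coxeter_group m :=
  match x with inl _ => 1 | inr s => cox_gen m s end.

Definition piK (a : virtual_artin) : coxeter_group m := pres_lift piK_gen a.

Lemma piK_gen_rel u v : va_rel u v -> eval_word piK_gen u = eval_word piK_gen v.
Proof.
have sq s : cox_gen m s * cox_gen m s = 1.
  by rewrite [LHS]pres_mul_pi; apply/pres_piP/pres_eq_rel/CoxSquare.
case=> [s t k _ _|s t k nst mst|s|s t k _ _].
- by rewrite !eval_altword1.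
- apply: eval_altword_comm; [exact: sq | exact: sq |].
  have: eval_word (cox_gen m) (posword (flatten (nseq k [:: s; t]))) = 1.
    by rewrite (pres_relE (CoxPower nst mst)) /eval_word big_nil.
  by rewrite eval_posword_pow.
- by rewrite !eval_posword_cons eval_posword_nil mulg1; exact: sq.
- by move=> P r; rewrite eval_posword_rcons eval_posword_cons mulg1 mul1g.
Qed.

HB.instance Definition _ := isGroupMorphism.Build virtual_artin
  (coxeter_group m) piK (pres_liftF piK_gen_rel).

Lemma piK_sigma s : piK (sigma s) = 1.
Proof. exact: (pres_lift_gen piK_gen_rel). Qed.

Lemma piK_tau s : piK (tau s) = cox_gen m s.
Proof. exact: (pres_lift_gen piK_gen_rel). Qed.

Definition KVA : set virtual_artin := [set g | piK g = 1].

End VirtualArtin.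

Arguments sigma {S} m s.
Arguments tau {S} m s.
Arguments piK {S} m a.
Arguments KVA {S} m _.

Definition centralizer (G : groupType) (E : set G) : set G :=
  [set g | forall e, E e -> commute g e].

(* Main.v *)
Require Import Defs.
From HB Require Import structures.
From mathcomp Require Import all_boot.
From mathcomp Require Import classical_sets boolp.
From mathcomp Require Import ssralg ssrnum poly algC cyclotomic.
From mathcomp Require Import zify ring.

(** Let [vroot] be the set of pairs (w sigma_s w^-1, w alpha_s), permuted by
W, and let A be the Artin group on [vroot] in which beta = w alpha_s and
gamma = w alpha_t satisfy the braid relation of length m_{s,t}.  As VA acts on
the set A * W underlying a semidirect product, A embeds in VA with image KVA,
and VA = KVA W.  An element of the centralizer is thus a w with a in A, w in W
and a delta_{w beta} = delta_beta a for every beta.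

A root beta and its opposite -beta satisfy no braid relation, so A
is the amalgam of the subgroups generated by the delta_gamma with gamma <> -beta,
respectively gamma <> beta.  Comparing normal forms shows that w beta = beta and
that a lies in both factors.  So w fixes all roots, whence w = 1, and a lies in
every subgroup generated by all standard generators but one.  In an Artin group
<X> and <F> meet in <F cap X>, by the set-theoretic retraction onto <X> of
Charney and Paris: A acts on pairs (y, h), with y a minimal representative of a
coset of W_X in the Coxeter group and h in A; the letter c moves y to y s_c,
unless y alpha_c = alpha_x with x in X, when it leaves y unchanged and multiplies
h by delta_x.  Hence a = 1. *)

Set Implicit Arguments.
Unset Strict Implicit.
Unset Printing Implicit Defensive.

Import Monoid.Theory.
Local Open Scope group_scope.

(** * Permutations of a type, generated subgroups, alternating products *)

(** The inverse is stored, so that inversion swaps the two fields; equality still depends only on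
    the forward map. *)
Record symg (T : Type) := Symg {
  symg_fun :> T -> T;
  symg_inv : T -> T;
  symgK : cancel symg_fun symg_inv;
  symgVK : cancel symg_inv symg_fun
}.

HB.instance Definition _ T := gen_eqMixin (symg T).
HB.instance Definition _ T := gen_choiceMixin (symg T).

Section SymmetricGroup.
Variable T : Type.

Lemma symg_ext (f g : symg T) : f =1 g -> f = g.
Proof.
case: f g => [f f' fK fVK] [g g' gK gVK] /= fg.
have {}fg : f = g by apply: funext.
subst g; have f'g' : f' = g' by apply: funext => x; rewrite -{1}[x]gVK fK.
by subst g'; congr Symg; apply: Prop_irrelevance.
Qed.

Definition symg1 := @Symg T id id (fun=> erefl) (fun=> erefl).
Definition symgM (f g : symg T) :=
  Symg (can_comp (@symgK _ f) (@symgK _ g))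
       (can_comp (@symgVK _ g) (@symgVK _ f)).
Definition symgV (f : symg T) := Symg (@symgVK _ f) (@symgK _ f).

Fact symgA : associative symgM. Proof. by move=> f g h; apply: symg_ext. Qed.
Fact symg1M : left_id symg1 symgM. Proof. by move=> f; apply: symg_ext. Qed.
Fact symgM1 : right_id symg1 symgM. Proof. by move=> f; apply: symg_ext. Qed.
Fact symgVM : left_inverse symg1 symgV symgM.
Proof. by move=> f; apply: symg_ext => x; rewrite /= symgK. Qed.
Fact symgMV : right_inverse symg1 symgV symgM.
Proof. by move=> f; apply: symg_ext => x; rewrite /= symgVK. Qed.

HB.instance Definition _ :=
  isGroup.Build (symg T) symgA symg1M symgM1 symgVM symgMV.

Lemma symgME (f g : symg T) x : (f * g) x = f (g x). Proof. by []. Qed.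
Lemma symg1E x : (1 : symg T) x = x. Proof. by []. Qed.

End SymmetricGroup.

Section GeneratedSubgroup.
Variables (X : Type) (G : groupType) (f : X -> G).

(** The subgroup generated by [f] on [Y], built by left multiplication: an induction then follows an
    element acting on a set letter by letter. *)
Inductive gen_by (Y : X -> Prop) : G -> Prop :=
| gen_by1 : gen_by Y 1
| gen_byS x a : Y x -> gen_by Y a -> gen_by Y (f x * a)
| gen_bySV x a : Y x -> gen_by Y a -> gen_by Y ((f x)^-1 * a).

Variable Y : X -> Prop.

Lemma gen_byM a b : gen_by Y a -> gen_by Y b -> gen_by Y (a * b).
Proof.
move=> ha hb; elim: ha => [|x c Yx _ IH|x c Yx _ IH]; first by rewrite mul1g.
- by rewrite -mulgA; apply: gen_byS.
- by rewrite -mulgA; apply: gen_bySV.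
Qed.

Lemma gen_by_gen x : Y x -> gen_by Y (f x).
Proof. by move=> Yx; rewrite -[f x]mulg1; apply: gen_byS Yx (gen_by1 _). Qed.

Lemma gen_by_genV x : Y x -> gen_by Y (f x)^-1.
Proof. by move=> Yx; rewrite -[_^-1]mulg1; apply: gen_bySV Yx (gen_by1 _). Qed.

Lemma gen_byV a : gen_by Y a -> gen_by Y a^-1.
Proof.
elim=> [|x c Yx _ IH|x c Yx _ IH]; first by rewrite invg1; apply: gen_by1.
- by rewrite invgM; apply: gen_byM (gen_by_genV Yx).
- by rewrite invgM invgK; apply: gen_byM (gen_by_gen Yx).
Qed.

Lemma gen_by_sub (Z : X -> Prop) a :
  (forall x, Y x -> Z x) -> gen_by Y a -> gen_by Z a.
Proof.
move=> YZ; elim=> [|x c Yx _ IH|x c Yx _ IH]; first exact: gen_by1.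
- by apply: gen_byS => //; apply: YZ.
- by apply: gen_bySV => //; apply: YZ.
Qed.

End GeneratedSubgroup.

Lemma morphV1 (G H : groupType) (f : G -> H) :
  {morph f : a b / a * b} -> f 1 = 1 /\ {morph f : a / a^-1}.
Proof.
move=> fM; have f1 : f 1 = 1 by apply: (mulgI (f 1)); rewrite -fM !mulg1.
by split=> // a; apply: (mulgI (f a)); rewrite -fM !mulgV.
Qed.

Section Presentations.
Variables (X : choiceType) (R : gword X -> gword X -> Prop).

Lemma pres_gen_by (a : pres_group R) : gen_by (pres_gen R) (fun=> True) a.
Proof.
rewrite -[a]reprK -eval_word_gen; elim: (repr a) => [|[x b] u IHu].
  by rewrite /eval_word big_nil; apply: gen_by1.
rewrite /eval_word big_cons; case: b => /=; first exact: gen_bySV.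
exact: gen_byS.
Qed.

Lemma pres_ind (P : pres_group R -> Prop) :
  P 1 -> (forall x a, P a -> P (pres_gen R x * a)) ->
  (forall x a, P a -> P ((pres_gen R x)^-1 * a)) -> forall a, P a.
Proof.
by move=> P1 PS PV a; elim: (pres_gen_by a) => // x c _ _; [apply: PS|apply: PV].
Qed.

End Presentations.

Section Alternating.

Fixpoint altprod (G : groupType) (x y : G) n : G :=
  if n is k.+1 then altprod y x k * x else 1.

Lemma eval_altwordE (X : choiceType) (G : groupType) (f : X -> G) x y n :
  eval_word f (posword (altword x y n)) = altprod (f x) (f y) n.
Proof.
elim: n x y => [|n IHn] x y; first exact: eval_posword_nil.
by rewrite [altword _ _ _]/= eval_posword_rcons IHn.
Qed.

Lemma altprod_morph (G H : groupType) (f : G -> H) x y n :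
  {morph f : a b / a * b} -> f (altprod x y n) = altprod (f x) (f y) n.
Proof.
move=> fM; elim: n x y => [|n IHn] x y /=; first by case: (morphV1 fM).
by rewrite fM IHn.
Qed.

Variable G : groupType.
Implicit Types x y : G.

Lemma altprod_split x y p n : altprod x y (p + n) =
  altprod (if odd n then y else x) (if odd n then x else y) p * altprod x y n.
Proof.
elim: n x y => [|n IHn] x y; first by rewrite addn0 mulg1.
by rewrite addnS /= IHn mulgA; case: (odd n).
Qed.

Lemma altprodSl x y n :
  altprod x y n.+1 = (if odd n then y else x) * altprod x y n.
Proof. by rewrite -add1n altprod_split /= mul1g. Qed.

Lemma invol_inv x : x * x = 1 -> x^-1 = x.
Proof. exact: mulg1_eq. Qed.

(** The inverse of an alternating word in involutions is the reversed word, so the product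
    alternates throughout and has [2n] letters. *)
Lemma altprod_pow x y n : x * x = 1 -> y * y = 1 ->
  (altprod x y n)^-1 * altprod y x n = (x * y) ^+ n.
Proof.
elim: n x y => [|n IHn] x y xx yy /=; first by rewrite mulVg.
rewrite invgM (invol_inv xx) -mulgA (mulgA _ _ y) IHn //.
rewrite mulgA expgS -!mulgA; congr (_ * _).
elim: n {IHn} => [|n IHn]; first by rewrite mul1g mulg1.
by rewrite !expgS -!mulgA IHn.
Qed.

Lemma altprodP x y n : x * x = 1 -> y * y = 1 ->
  altprod x y n = altprod y x n <-> (x * y) ^+ n = 1.
Proof.
move=> xx yy; rewrite -(altprod_pow n xx yy); split=> [->|h]; first exact: mulVg.
by apply/esym/(mulgI (altprod x y n)^-1); rewrite h mulVg.
Qed.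

End Alternating.

(** * Coxeter groups and the universal property of their presentation *)

Section CoxeterBasics.
Variables (S : countType) (m : coxeterMatrix S).
Notation W := (coxeter_group m).
Notation s_ := (cox_gen m).

Lemma cox_gen_sq i : s_ i * s_ i = 1.
Proof. by rewrite [LHS]pres_mul_pi; apply/pres_piP/pres_eq_rel/CoxSquare. Qed.

Lemma cox_genV i : (s_ i)^-1 = s_ i.
Proof. exact/invol_inv/cox_gen_sq. Qed.

Lemma cox_gen_pow i j k : i != j -> m i j = Some k -> (s_ i * s_ j) ^+ k = 1.
Proof.
move=> nij mij; rewrite -(eval_posword_pow s_ i j k).
by rewrite (pres_relE (CoxPower nij mij)) /eval_word big_nil.
Qed.

Lemma cox_gen_braid i j k : i != j -> m i j = Some k ->
  altprod (s_ i) (s_ j) k = altprod (s_ j) (s_ i) k.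
Proof.
by move=> nij mij; apply/altprodP; [exact: cox_gen_sq.. | exact: cox_gen_pow].
Qed.

Lemma cox_ind (P : W -> Prop) :
  P 1 -> (forall i w, P w -> P (s_ i * w)) -> forall w, P w.
Proof. by move=> P1 PS; apply: pres_ind => // i w; rewrite ?cox_genV; apply: PS. Qed.

Section Lift.
Variables (H : groupType) (f : S -> H).
Hypothesis f_sq : forall i, f i * f i = 1.
Hypothesis f_pow :
  forall i j k, i != j -> m i j = Some k -> (f i * f j) ^+ k = 1.

Lemma cox_lift_rel u v : coxeter_rel m u v -> eval_word f u = eval_word f v.
Proof.
case=> [i|i j k nij mij]; rewrite [RHS]/eval_word big_nil.
  by rewrite !eval_posword_cons eval_posword_nil mulg1.
by rewrite eval_posword_pow; apply: f_pow.
Qed.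

Definition cox_lift : W -> H := @pres_lift S (coxeter_rel m) H f.

Lemma cox_liftM : {morph cox_lift : a b / a * b}.
Proof. exact: (pres_liftM cox_lift_rel). Qed.

Lemma cox_lift_gen i : cox_lift (s_ i) = f i.
Proof. exact: (pres_lift_gen cox_lift_rel). Qed.

End Lift.
End CoxeterBasics.

(** * The (dual) geometric representation *)

Section ReflectionPlane.
Local Open Scope ring_scope.
Import GRing.Theory.
Variables (S : eqType) (K : fieldType) (c : S -> S -> K).
Hypothesis cii : forall i, c i i = - 2%:R.

(** Here [f l] is the value of a linear form at the simple root of [l]. The form is composed with
    the reflection that adds [c i l] times the root of [i] to the root of [l]; forms are arbitrary
    functions even when [S] is infinite. *)
Definition refl i (f : S -> K) : S -> K := fun l => f l + c i l * f i.

Lemma reflK i : involutive (refl i).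
Proof. by move=> f; apply: funext => l; rewrite /refl cii; ring. Qed.

Variables (i j : S) (z : K).
Hypotheses (z0 : z != 0) (cij : c i j = z + z^-1) (cji : c j i = z + z^-1).

Let e f := refl i (refl j f).

(* [fun f => f i + r * f j], for [r = z] or [r = z^-1], is an eigenform of [e]
   for the eigenvalue [r ^+ 2]. *)
Lemma refl2_eigen r f : (r == z) || (r == z^-1) ->
  e f i + r * e f j = r ^+ 2 * (f i + r * f j).
Proof.
by case/orP => /eqP->; rewrite /e /refl !cii cij cji; field.
Qed.

Lemma refl2_eigen_iter r n f : (r == z) || (r == z^-1) ->
  iter n e f i + r * iter n e f j = (r ^+ 2) ^+ n * (f i + r * f j).
Proof.
move=> hr; elim: n => [|n IHn]; first by rewrite expr0 mul1r.
by rewrite iterS refl2_eigen // IHn mulrA -exprS.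
Qed.

(** The difference [e f - f] depends only on [f i] and [f j], which the two eigenforms determine
    when [z] differs from its inverse. *)
Lemma refl2_step f l : z ^+ 2 != 1 ->
  e f l = f l + ((f i + z * f j) * (c j l + z * c i l)
                 - (f i + z^-1 * f j) * (c j l + z^-1 * c i l)) / (z - z^-1).
Proof.
move=> z21; have d0 : z ^+ 2 - 1 != 0 by rewrite subr_eq0.
rewrite /e /refl cji; field.
by rewrite z0 -expr2.
Qed.

(** Summing the steps, each eigenform contributes a geometric series, which vanishes at roots of
    unity other than 1. *)
Lemma refl2_iter n f l : z ^+ 2 != 1 ->
  iter n e f l = f l +
    ((\sum_(p < n) (z ^+ 2) ^+ p) * ((f i + z * f j) * (c j l + z * c i l))
     - (\sum_(p < n) (z^-1 ^+ 2) ^+ p) *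
       ((f i + z^-1 * f j) * (c j l + z^-1 * c i l))) / (z - z^-1).
Proof.
move=> z21; elim: n => [|n IHn]; first by rewrite !big_ord0 !mul0r subrr mul0r addr0.
rewrite iterS refl2_step // IHn !refl2_eigen_iter ?eqxx ?orbT //.
by rewrite !big_ord_recr /=; ring.
Qed.

Lemma geo_sum0 (q : K) n : q != 1 -> q ^+ n = 1 -> \sum_(p < n) q ^+ p = 0.
Proof.
move=> q1 qn; apply: (mulfI (x := q - 1)); first by rewrite subr_eq0.
by rewrite -subrX1 qn subrr mulr0.
Qed.

Lemma refl2_order n f : z ^+ 2 != 1 -> (z ^+ 2) ^+ n = 1 -> iter n e f = f.
Proof.
move=> z21 zn; apply: funext => l; rewrite refl2_iter //.
rewrite !geo_sum0 ?exprVn ?invr_eq1 ?zn ?invr1 //.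
by rewrite !mul0r subrr mul0r addr0.
Qed.

(** For [z = 1] the eigenforms coincide: [f i + f j] is invariant and [f i] drifts linearly, which
    gives infinite order in characteristic 0. *)
Lemma refl2_unip n f : z = 1 -> iter n e f i = f i - 2%:R * n%:R * (f i + f j).
Proof.
move=> z1; elim: n => [|n IHn]; first by rewrite mulr0 mul0r subr0.
have := @refl2_eigen_iter 1 n f; rewrite !z1 eqxx !expr1n !mul1r => /(_ isT) L.
rewrite iterS {1}/e /refl !cii cji z1 invr1.
have {L}-> : iter n e f j = f i + f j - iter n e f i by rewrite -L addrC addKr.
by rewrite IHn -natr1; ring.
Qed.

End ReflectionPlane.

Section GeometricRepresentation.
Local Open Scope ring_scope.
Import GRing.Theory Num.Theory.
Variables (S : countType) (m : coxeterMatrix S).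
Notation W := (coxeter_group m).
Notation s_ := (cox_gen m).

(* A square root of a primitive [m i j]-th root of unity: up to sign,
   [zeta + zeta^-1] is a Galois conjugate of [2 cos (pi / m i j)]; it is [2] if
   [m i j] is infinite. *)
Definition zeta i j : algC :=
  if m i j is Some k.+1 then sqrtC (sval (C_prim_root_exists (ltn0Sn k))) else 1.

Definition cox_coef i j : algC :=
  if i == j then - 2%:R else zeta i j + (zeta i j)^-1.

Lemma zeta_sym i j : zeta i j = zeta j i.
Proof. by rewrite /zeta cox_sym. Qed.

Lemma zetaP i j k : (0 < k)%N -> m i j = Some k ->
  k.-primitive_root (zeta i j ^+ 2).
Proof.
rewrite /zeta => + mij; rewrite mij; case: k {mij} => // k _.
by rewrite sqrtCK; case: (C_prim_root_exists _).
Qed.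

Lemma zeta_neq0 i j : zeta i j != 0.
Proof.
rewrite /zeta; case: (m i j) => [[|k]|]; rewrite ?oner_neq0 // sqrtC_eq0.
case: (C_prim_root_exists _) => z /= /prim_expr_order zk.
by apply/eqP => z0; move/eqP: zk; rewrite z0 expr0n eq_sym oner_eq0.
Qed.

Lemma cox_coef_ii i : cox_coef i i = - 2%:R.
Proof. by rewrite /cox_coef eqxx. Qed.

Lemma cox_coef_ij i j : i != j -> cox_coef i j = zeta i j + (zeta i j)^-1.
Proof. by rewrite /cox_coef => /negbTE->. Qed.

Lemma cox_coef_ji i j : i != j -> cox_coef j i = zeta i j + (zeta i j)^-1.
Proof. by rewrite eq_sym zeta_sym; apply: cox_coef_ij. Qed.

Definition refl_sym i : symg (S -> algC) :=
  Symg (reflK cox_coef_ii i) (reflK cox_coef_ii i).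

Lemma refl_sym_sq i : (refl_sym i * refl_sym i = 1)%g.
Proof. by apply: symg_ext => f; apply: (reflK cox_coef_ii). Qed.

Lemma refl_symX i j n f : ((refl_sym i * refl_sym j) ^+ n)%g f =
  iter n (fun g => refl cox_coef i (refl cox_coef j g)) f.
Proof. by elim: n => [|n IHn] //; rewrite expgS iterS -IHn. Qed.

Lemma zeta2_neq1 i j k : i != j -> m i j = Some k -> zeta i j ^+ 2 != 1.
Proof.
move=> nij mij; have k2 := cox_offdiag nij mij.
have pz := zetaP (ltnW k2) mij; apply/eqP => z1.
by have := prim_order_dvd pz 1; rewrite z1 expr1n eqxx dvdn1 => /eqP k1; lia.
Qed.

Lemma refl_sym_pow i j k : i != j -> m i j = Some k ->
  ((refl_sym i * refl_sym j) ^+ k = 1)%g.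
Proof.
move=> nij mij; apply: symg_ext => f; rewrite refl_symX.
have k2 := cox_offdiag nij mij; have pz := zetaP (ltnW k2) mij.
apply: (refl2_order cox_coef_ii (zeta_neq0 i j)) => //.
- exact: cox_coef_ij.
- exact: cox_coef_ji.
- exact: zeta2_neq1 nij mij.
- exact: prim_expr_order.
Qed.

Definition geo_rep : W -> symg (S -> algC) := cox_lift refl_sym.

Lemma geo_repM : {morph geo_rep : a b / (a * b)%g}.
Proof. exact: cox_liftM refl_sym_sq refl_sym_pow. Qed.

Lemma geo_rep_gen i : geo_rep (s_ i) = refl_sym i.
Proof. exact: cox_lift_gen refl_sym_sq refl_sym_pow i. Qed.

Lemma geo_repX w n : geo_rep (w ^+ n)%g = (geo_rep w ^+ n)%g.
Proof.
have [r1 _] := morphV1 geo_repM.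
by elim: n => [|n IHn]; rewrite ?expg0 // !expgS geo_repM IHn.
Qed.

(** Both cases test the indicator function of [i]. Its eigenform has value 1 and is multiplied by
    [(zeta i j ^+ 2) ^+ n]; if [m i j] is infinite, its value at [i] is shifted by [- 2n], which is
    nonzero. *)
Lemma cox_gen_order i j n : i != j -> (0 < n)%N -> ((s_ i * s_ j) ^+ n = 1)%g ->
  exists2 k, m i j = Some k & (k %| n)%N.
Proof.
move=> nij n0 /(congr1 geo_rep); have [r1 _] := morphV1 geo_repM.
rewrite geo_repX geo_repM !geo_rep_gen r1.
pose f l : algC := (l == i)%:R.
move=> /(congr1 (fun g : symg _ => g f)); rewrite refl_symX /= => ef.
have fi : f i = 1 by rewrite /f eqxx.
have fj : f j = 0 by rewrite /f eq_sym (negbTE nij).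
case mij: (m i j) => [k|].
  exists k => //; have k2 := cox_offdiag nij mij.
  rewrite (prim_order_dvd (zetaP (ltnW k2) mij)).
  have := @refl2_eigen_iter _ _ _ cox_coef_ii i j _ (zeta_neq0 i j)
    (cox_coef_ij nij) (cox_coef_ji nij) (zeta i j) n f.
  by rewrite eqxx => /(_ isT); rewrite ef fi fj mulr0 addr0 mulr1 => <-.
have z1 : zeta i j = 1 by rewrite /zeta mij.
have := refl2_unip cox_coef_ii (zeta_neq0 i j)
    (cox_coef_ij nij) (cox_coef_ji nij) n f z1.
rewrite ef fi fj addr0 mulr1 => /eqP.
rewrite eq_sym -subr_eq0 addrAC subrr sub0r oppr_eq0 mulf_eq0 !pnatr_eq0 /=.
by move=> /eqP n00; move: n0; rewrite n00.
Qed.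

(** The indicator function of [x] is fixed by every [s_ y] with [y] other than [x], while [s_ x]
    changes its value at [x] from 1 to -1. *)
Lemma gen_by_cox_gen (Y : S -> Prop) x : gen_by s_ Y (s_ x) -> Y x.
Proof.
move=> gx; apply: contrapT => nYx; pose f l : algC := (l == x)%:R.
have fixf w : gen_by s_ Y w -> geo_rep w f = f.
  have [r1 _] := morphV1 geo_repM.
  have sf y : Y y -> refl cox_coef y f = f.
    move=> Yy; apply: funext => l; rewrite /refl /f (_ : (y == x) = false).
      by rewrite mulr0 addr0.
    by apply/eqP => yx; rewrite yx in Yy.
  elim=> [|y a Yy _ IH|y a Yy _ IH]; first by rewrite r1.
    by rewrite geo_repM symgME IH geo_rep_gen /= sf.
  by rewrite cox_genV geo_repM symgME IH geo_rep_gen /= sf.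
have := congr1 (@^~ x) (fixf _ gx); rewrite geo_rep_gen /= /refl /f eqxx.
rewrite cox_coef_ii mulr1 => /eqP; rewrite addrC -subr_eq0 addrK oppr_eq0.
by rewrite pnatr_eq0.
Qed.

Lemma cox_gen_inj : injective s_.
Proof.
move=> i j ij; have: gen_by s_ (eq^~ j) (s_ i) by rewrite ij; apply: gen_by_gen.
exact: gen_by_cox_gen.
Qed.

Lemma cox_gen_neq1 i : s_ i != 1%g.
Proof.
apply/eqP => i1; suff: gen_by s_ (fun=> False) (s_ i) by move/gen_by_cox_gen.
by rewrite i1; apply: gen_by1.
Qed.

(** Conjugation preserves the order of a product of two generators, so the two entries divide each
    other. *)
Lemma cox_conj_order (g : W) i j x y k :
  (g * s_ i * g^-1 = s_ x)%g -> (g * s_ j * g^-1 = s_ y)%g ->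
  i != j -> m i j = Some k -> x != y /\ m x y = Some k.
Proof.
move=> Ex Ey nij mij.
have nxy : x != y.
  apply: contraNneq nij => xy; apply/eqP/cox_gen_inj/(mulgI g).
  by apply: (mulIg g^-1)%g; rewrite Ex Ey xy.
split=> //; have k2 := cox_offdiag nij mij.
have conjX n : ((s_ x * s_ y) ^+ n = g * (s_ i * s_ j) ^+ n * g^-1)%g.
  rewrite -Ex -Ey (_ : _ * _ = g * (s_ i * s_ j) * g^-1)%g; last first.
    by rewrite !mulgA mulgVK.
  elim: n => [|n IHn]; first by rewrite mulg1 mulgV.
  by rewrite !expgS IHn !mulgA mulgVK.
have kxy : ((s_ x * s_ y) ^+ k = 1)%g.
  by rewrite conjX (cox_gen_pow nij mij) mulg1 mulgV.
have [k' mxy dk'] := cox_gen_order nxy (ltnW k2) kxy.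
have k'2 := cox_offdiag nxy mxy.
have : ((s_ i * s_ j) ^+ k' = 1)%g.
  apply: (mulgI g); apply: (mulIg g^-1)%g.
  by rewrite -conjX (cox_gen_pow nxy mxy) mulg1 mulgV.
move=> /(cox_gen_order nij (ltnW k'2))[k'']; rewrite mij => -[<-] dk.
by rewrite mxy; congr Some; apply/eqP; rewrite eqn_dvd dk dk'.
Qed.

End GeometricRepresentation.

(** * Signs of roots, exchange condition, minimal coset representatives *)

Lemma conj_eqVM (G : groupType) (a x y : G) :
  (a * x * a^-1 == y) = (x == a^-1 * y * a).
Proof.
by apply/eqP/eqP => [<- | ->]; rewrite !mulgA ?mulVg ?mulgV mul1g ?mulgVK ?mulgK.
Qed.

Section Signs.
Variables (S : countType) (m : coxeterMatrix S).
Notation W := (coxeter_group m).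
Notation s_ := (cox_gen m).

(* The pair [(g, e)] stands for the root of sign [e] ([true] for negative)
   whose reflection is [g]; this makes sense for every [g] in [W]. *)
Definition root_refl i (r : W * bool) := (s_ i * r.1 * s_ i, r.2 (+) (r.1 == s_ i)).

Lemma root_reflK i : involutive (root_refl i).
Proof.
case=> g e; rewrite /root_refl /= -!mulgA cox_gen_sq mulg1 !mulgA cox_gen_sq mul1g.
have := conj_eqVM (s_ i) g (s_ i); rewrite cox_genV cox_gen_sq mul1g => ->.
by rewrite -addbA addbb addbF.
Qed.

Definition root_sym i := Symg (root_reflK i) (root_reflK i).

Lemma root_sym_sq i : root_sym i * root_sym i = 1.
Proof. by apply: symg_ext => r; apply: root_reflK. Qed.

Lemma cox_rot_conj i j n :
  s_ j * (s_ i * s_ j) ^+ n = (s_ i * s_ j) ^- n * s_ j.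
Proof.
elim: n => [|n IHn]; first by rewrite invg1 mulg1 mul1g.
rewrite {1}expgSr mulgA IHn expgS invgM -!mulgA; congr (_ * _).
by rewrite invgM !cox_genV -mulgA.
Qed.

(** Sign flips are counted modulo 2: the letter of index [q] from the right, starting at 0, flips
    the sign exactly for the reflection [(s_ i * s_ j) ^- q * s_ j]. *)
Lemma root_symX i j n g e : ((root_sym i * root_sym j) ^+ n) (g, e) =
  ((s_ i * s_ j) ^+ n * g * (s_ i * s_ j) ^- n,
   e (+) \big[addb/false]_(0 <= q < n.*2) (g == (s_ i * s_ j) ^- q * s_ j)).
Proof.
elim: n => [|n IHn]; first by rewrite big_nil addbF invg1 mulg1 mul1g.
set r := s_ i * s_ j in IHn *.
rewrite expgS !symgME IHn /= /root_refl /= doubleS !big_nat_recr //=.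
congr pair.
  by rewrite expgS invgM /r [in RHS]invgM !cox_genV -!mulgA.
have -> : (s_ j * (r ^+ n * g * r ^- n) * s_ j == s_ i)
        = (g == r ^- n.*2.+1 * s_ j).
  have := conj_eqVM (s_ j) (r ^+ n * g * r ^- n) (s_ i).
  rewrite cox_genV conj_eqVM => ->.
  rewrite -!mulgA cox_rot_conj -/r !mulgA; congr (_ == _ * _).
  rewrite -(mulgA _ (s_ j)) (_ : s_ j * s_ i = r^-1); last by rewrite invgM !cox_genV.
  by rewrite -!invgM -expgS -expgnDr -addnn addnS.
rewrite conj_eqVM -mulgA cox_rot_conj -/r mulgA -invgM -expgnDr addnn.
by rewrite !addbA.
Qed.

Lemma root_sym_pow i j k : i != j -> m i j = Some k ->
  (root_sym i * root_sym j) ^+ k = 1.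
Proof.
move=> nij mij; apply: symg_ext => -[g e]; rewrite root_symX symg1E.
rewrite (cox_gen_pow nij mij) invg1 mulg1 mul1g; congr pair.
(* As [(s_ i * s_ j) ^+ k = 1], the letters of index [q] and [k + q] flip the same root, so the [2k]
   flips cancel in pairs. *)
rewrite -addnn (big_cat_nat _ (leq_addr k k)) //=.
rewrite -{2}[k]add0n big_addn addnK [X in _ (+) (_ (+) X)](_ : _ =
  \big[addb/false]_(0 <= q < k) (g == (s_ i * s_ j) ^- q * s_ j)).
  by rewrite addbb addbF.
by apply: eq_bigr => q _; rewrite expgnDr (cox_gen_pow nij mij) mulg1.
Qed.

Definition root_rep : W -> symg (W * bool) := cox_lift root_sym.

Lemma root_repM : {morph root_rep : a b / a * b}.
Proof. exact: cox_liftM root_sym_sq root_sym_pow. Qed.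

Lemma root_rep_gen i : root_rep (s_ i) = root_sym i.
Proof. exact: cox_lift_gen root_sym_sq root_sym_pow i. Qed.

Lemma root_rep1 : root_rep 1 = 1.
Proof. by case: (morphV1 root_repM). Qed.

(** The sign cocycle: for a reflection [g], whether [w] makes the positive root of [g] negative. *)
Definition rsign (w g : W) := (root_rep w (g, false)).2.

Lemma root_repE w g e : root_rep w (g, e) = (w * g * w^-1, e (+) rsign w g).
Proof.
elim/cox_ind: w g e => [|i w IHw] g e.
  by rewrite /rsign root_rep1 invg1 mulg1 mul1g /= addbF.
rewrite [rsign (_ * _) _]/rsign root_repM !symgME !IHw root_rep_gen /=.
by rewrite /root_refl /= invgM cox_genV !mulgA addbA.
Qed.

Lemma rsignM w v g : rsign (w * v) g = rsign v g (+) rsign w (v * g * v^-1).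
Proof. by rewrite [LHS]/rsign root_repM symgME !root_repE. Qed.

Lemma rsign_gen i g : rsign (s_ i) g = (g == s_ i).
Proof. by rewrite /rsign root_rep_gen. Qed.

Lemma rsign1 g : rsign 1 g = false.
Proof. by rewrite /rsign root_rep1. Qed.

Lemma rsignV w g : rsign w^-1 g = rsign w (w^-1 * g * w).
Proof.
have := rsignM w w^-1 g; rewrite mulgV rsign1 invgK.
by case: (rsign w^-1 g) (rsign w _) => -[].
Qed.

Lemma rsignMgen w i : rsign (w * s_ i) (s_ i) = ~~ rsign w (s_ i).
Proof. by rewrite rsignM rsign_gen eqxx mulgK. Qed.

Definition wprod (u : seq S) : W := \prod_(i <- u) s_ i.

Lemma wprod_nil : wprod [::] = 1. Proof. exact: big_nil. Qed.
Lemma wprod_cons i u : wprod (i :: u) = s_ i * wprod u. Proof. exact: big_cons. Qed.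
Lemma wprod_cat u v : wprod (u ++ v) = wprod u * wprod v. Proof. exact: big_cat. Qed.
Lemma wprod_rcons u i : wprod (rcons u i) = wprod u * s_ i.
Proof. by rewrite -cats1 wprod_cat wprod_cons wprod_nil mulg1. Qed.

Lemma wprod_mulrev u : wprod u * wprod (rev u) = 1.
Proof.
elim: u => [|i w IHw]; first by rewrite wprod_nil mulg1.
rewrite rev_cons wprod_rcons wprod_cons -mulgA (mulgA (wprod w)) IHw mul1g.
exact: cox_gen_sq.
Qed.

Lemma wprod_surj w : exists u, wprod u = w.
Proof.
elim/cox_ind: w => [|i w [u <-]]; first by exists [::]; rewrite wprod_nil.
by exists (i :: u); rewrite wprod_cons.
Qed.

(** Reading [u] from the right, the root of [i] turns negative at some letter [k], when it has
    become the root of [k]; the tail [v] to the right of [k] then satisfies [s_ k * v = v * s_ i],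
    so [k] can be deleted. *)
Lemma exchange u i : rsign (wprod u) (s_ i) ->
  exists u1 k u2, u = u1 ++ k :: u2 /\ wprod u * s_ i = wprod (u1 ++ u2).
Proof.
elim: u => [|k u IHu]; first by rewrite wprod_nil rsign1.
rewrite wprod_cons rsignM rsign_gen.
case e: (rsign (wprod u) (s_ i)) => /=.
  move=> _; have [u1 [k' [u2 [-> E]]]] := IHu e.
  exists (k :: u1), k', u2; split=> //.
  by rewrite cat_cons wprod_cons -E mulgA.
move=> /eqP E; exists [::], k, u; split=> //=.
by rewrite -mulgA -[wprod u * _](mulgVK (wprod u)) E mulgA cox_gen_sq mul1g.
Qed.

Fact clen_subproof w : exists n, `[< exists2 u, wprod u = w & size u = n >].
Proof. by have [u <-] := wprod_surj w; exists (size u); apply/asboolP; exists u. Qed.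

Definition clen w := ex_minn (clen_subproof w).

Lemma clen_word w : exists2 u, wprod u = w & size u = clen w.
Proof. by rewrite /clen; case: ex_minnP => n /asboolP[u <- <-] _; exists u. Qed.

Lemma clen_le u : clen (wprod u) <= size u.
Proof. by rewrite /clen; case: ex_minnP => n _; apply; apply/asboolP; exists u. Qed.

Lemma clen_mulgen w i : clen (w * s_ i) <= (clen w).+1.
Proof.
have [u <- <-] := clen_word w.
by rewrite -wprod_rcons -(size_rcons u i); apply: clen_le.
Qed.

Lemma clen_genmul w i : clen (s_ i * w) <= (clen w).+1.
Proof. by have [u <- <-] := clen_word w; rewrite -wprod_cons; apply: clen_le. Qed.

Lemma clen_lt w i : rsign w (s_ i) -> clen (w * s_ i) < clen w.
Proof.
have [u <- <-] := clen_word w => /exchange[u1 [k [u2 [-> ->]]]].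
by apply: leq_ltn_trans (clen_le _) _; rewrite !size_cat /= addnS.
Qed.

Lemma clen_gt w i : ~~ rsign w (s_ i) -> clen (w * s_ i) = (clen w).+1.
Proof.
rewrite -rsignMgen => /clen_lt; rewrite -mulgA cox_gen_sq mulg1 => h.
by apply/eqP; rewrite eqn_leq h clen_mulgen.
Qed.

(** The last letter of a shortest word for [w] is such an [i]. *)
Lemma cox_neq1_neg w : w != 1 -> exists i, rsign w (s_ i).
Proof.
have [u <- Eu] := clen_word w; case/lastP: u Eu => [|u i] Eu.
  by rewrite wprod_nil eqxx.
move=> _; exists i; apply: contraTT isT => /clen_gt.
rewrite -Eu wprod_rcons -mulgA cox_gen_sq mulg1 size_rcons.
by have := clen_le u; lia.
Qed.

(** * Additivity of lengths in a coset of a parabolic subgroup *)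

Section Coset.
Variables (Y : pred S) (y : W).
Hypothesis y_min : forall v, all Y v -> clen y <= clen (y * wprod v).

Definition min_word u :=
  all Y u /\ forall v, all Y v -> wprod v = wprod u -> size u <= size v.

Lemma min_wordP v : all Y v -> exists2 u, wprod u = wprod v & min_word u.
Proof.
elim: {v}_.+1 {-2}v (ltnSn (size v)) => // n IHn v; rewrite ltnS => vn Yv.
case: (pselect (min_word v)) => [mv|nmv]; first by exists v.
have [v' [Yv' Ev' sv']] : exists v', [/\ all Y v', wprod v' = wprod v & size v' < size v].
  apply: contrapT => h; apply: nmv; split=> // v' Yv' Ev'.
  by rewrite leqNgt; apply/negP => sv'; apply: h; exists v'.
by have [u Eu mu] := IHn v' (leq_trans sv' vn) Yv'; exists u; rewrite // Eu.
Qed.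

Lemma min_word_prefix u k : min_word (rcons u k) -> min_word u.
Proof.
move=> [/[!all_rcons]/andP[Yk Yu] umin]; split=> // v Yv Ev.
have := umin (rcons v k); rewrite all_rcons Yk Yv !wprod_rcons Ev !size_rcons.
by move=> /(_ isT erefl).
Qed.

(** If a letter failed to increase the length, exchange would delete a letter either of [u], which
    was shortest, or of a word of [y], which was minimal in its coset. *)
Lemma clen_coset u : min_word u -> clen (y * wprod u) = clen y + size u.
Proof.
elim/last_ind: u => [|u k IHu] mu; first by rewrite wprod_nil mulg1 addn0.
have {}IHu := IHu (min_word_prefix mu).
have [/[!all_rcons]/andP[Yk Yu] umin] := mu.
rewrite wprod_rcons mulgA size_rcons addnS -IHu; apply: clen_gt; apply/negP.
have [v Ev sv] := clen_word y.
rewrite -Ev -wprod_cat => /exchange[u1 [k' [u2 [E]]]]; rewrite wprod_cat => H.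
have [le1|lt1] := leqP (size v) (size u1).
  have Eu1 : u1 = v ++ drop (size v) u1.
    by have := congr1 (take (size v)) E;
       rewrite take_size_cat // takel_cat // => {1}->; rewrite cat_take_drop.
  move: E H; rewrite {}Eu1 -!catA => /eqP.
  rewrite eqseq_cat // eqxx /= => /eqP E; rewrite [in RHS]wprod_cat -mulgA => /mulgI.
  rewrite -wprod_rcons => /esym E'; have := umin _ _ E'.
  move: Yu; rewrite E all_cat /= all_cat => /and3P[-> _ ->] /(_ isT).
  by rewrite size_rcons !size_cat /=; lia.
have Eu : u2 = drop (size u1).+1 v ++ u.
  have := congr1 (drop (size u1).+1) E.
  rewrite -cat_rcons -(size_rcons u1 k') (drop_size_cat u2 erefl) drop_cat size_rcons => <-.
  case: (ltnP (size u1).+1 (size v)) => // le2.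
  have -> : (size u1).+1 = size v by apply/eqP; rewrite eqn_leq lt1 le2.
  by rewrite subnn drop0 drop_size.
(* The deleted letter lies in the word [v] of [y]; multiplying by the inverse of [u] gives an
   element of the coset shorter than [y]. *)
have := y_min (v := rcons u k ++ rev u).
rewrite all_cat all_rcons Yk all_rev Yu => /(_ isT).
rewrite wprod_cat wprod_rcons !mulgA -[in y * wprod u]Ev H Eu !wprod_cat -!mulgA.
rewrite wprod_mulrev mulg1 -wprod_cat => h; have := leq_trans h (clen_le _).
by rewrite -sv size_cat size_drop; lia.
Qed.

End Coset.

Lemma coset_decomp (Y : pred S) y : exists y0 u,
  [/\ forall v, all Y v -> clen y0 <= clen (y0 * wprod v),
      min_word Y u & y = y0 * wprod u].
Proof.
pose P n := `[< exists2 v, all Y v & clen (y * wprod v) = n >].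
have exP : exists n, P n.
  by exists (clen (y * wprod [::])); apply/asboolP; exists [::].
case: (ex_minnP exP) => n /asboolP[v Yv <-] vmin.
have Yrv : all Y (rev v) by rewrite all_rev.
have [u Eu mu] := min_wordP Yrv.
exists (y * wprod v), u; split=> //; last by rewrite Eu -mulgA wprod_mulrev mulg1.
move=> v' Yv'; rewrite -mulgA -wprod_cat; apply/vmin/asboolP.
by exists (v ++ v'); rewrite // all_cat Yv.
Qed.

End Signs.

(** * Retractions of Artin groups onto standard parabolic subgroups *)

Section Artin.
Variables (S : countType) (m : coxeterMatrix S).

Inductive artin_rel : gword S -> gword S -> Prop :=
| ArtinBraid s t k : s != t -> m s t = Some k ->
    artin_rel (posword (altword s t k)) (posword (altword t s k)).

Definition artin := pres_group artin_rel.
HB.instance Definition _ := Group.on artin.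

Definition artin_gen (s : S) : artin := pres_gen artin_rel s.

Lemma artin_gen_braid i j k : i != j -> m i j = Some k ->
  altprod (artin_gen i) (artin_gen j) k = altprod (artin_gen j) (artin_gen i) k.
Proof.
move=> nij mij; rewrite -!(eval_altwordE artin_gen).
exact: pres_relE (ArtinBraid nij mij).
Qed.

Section Lift.
Variables (H : groupType) (f : S -> H).
Hypothesis f_braid : forall i j k, i != j -> m i j = Some k ->
  altprod (f i) (f j) k = altprod (f j) (f i) k.

Lemma artin_lift_rel u v : artin_rel u v -> eval_word f u = eval_word f v.
Proof. by case=> i j k nij mij; rewrite !eval_altwordE; apply: f_braid. Qed.

Definition artin_lift : artin -> H := @pres_lift S artin_rel H f.

Lemma artin_liftM : {morph artin_lift : a b / a * b}.
Proof. exact: (pres_liftM artin_lift_rel). Qed.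

Lemma artin_lift1 : artin_lift 1 = 1.
Proof. by case: (morphV1 artin_liftM). Qed.

Lemma artin_liftV : {morph artin_lift : a / a^-1}.
Proof. by case: (morphV1 artin_liftM). Qed.

Lemma artin_lift_gen i : artin_lift (artin_gen i) = f i.
Proof. exact: (pres_lift_gen artin_lift_rel). Qed.

End Lift.
End Artin.

(** * The action on pairs of a reduced element and an element of the Artin group *)

Section Retraction.
Variables (S : countType) (m : coxeterMatrix S) (X : S -> Prop).
Notation W := (coxeter_group m).
Notation A := (artin m).
Notation s_ := (cox_gen m).
Notation d_ := (artin_gen m).

(** These are the shortest elements of the cosets [W_X y]. *)
Definition Xreduced (y : W) := forall x, X x -> rsign y^-1 (s_ x) = false.

(* [y] maps the simple root of [c] to the simple root of [x]. *)
Definition emits y c x :=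
  [/\ X x, y * s_ c * y^-1 = s_ x & rsign y (s_ c) = false].

Definition emission y c : option S :=
  if pselect (exists x, emits y c x) is left h then Some (projT1 (cid h)) else None.

Lemma emission_Some y c x : emission y c = Some x <-> emits y c x.
Proof.
rewrite /emission; case: pselect => [h|nh]; last by split=> // h; case: nh; exists x.
case: (cid h) => x' [Xx' E' s'] /=; split=> [[<-] //|[Xx E _]].
by congr Some; apply: (@cox_gen_inj _ m); rewrite -E -E'.
Qed.

Lemma emission_None y c : (forall x, ~ emits y c x) -> emission y c = None.
Proof.
by move=> h; case e: (emission y c) => [x|//]; case: (h x); apply/emission_Some.
Qed.

Lemma Xreduced1 : Xreduced 1.
Proof. by move=> x _; rewrite invg1 rsign1. Qed.

Lemma rsign_conj y c x : y * s_ c * y^-1 = s_ x -> rsign y (s_ c) = rsign y^-1 (s_ x).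
Proof. by move=> <-; rewrite rsignV !mulgA mulVg mul1g mulgVK. Qed.

(** Multiplication by [s_ c] can spoil positivity only for the root that [y] makes of [alpha_c],
    hence only if that root is simple in [X]. *)
Lemma Xreduced_move y c : Xreduced y -> emission y c = None -> Xreduced (y * s_ c).
Proof.
move=> Dy nE x Xx; rewrite invgM cox_genV rsignM Dy // rsign_gen invgK /=.
apply/negP => /eqP E; suff: emission y c = Some x by rewrite nE.
have E' : y * s_ c * y^-1 = s_ x by rewrite -E !mulgA mulgV mul1g mulgK.
by apply/emission_Some; split=> //; rewrite (rsign_conj E') Dy.
Qed.

Lemma emission_move y c : Xreduced y -> emission (y * s_ c) c = None.
Proof.
move=> Dy; apply: emission_None => x [Xx]; rewrite rsignMgen invgM cox_genV.
rewrite -!mulgA (mulgA (s_ c) (s_ c)) cox_gen_sq mul1g mulgA => E.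
by rewrite (rsign_conj E) Dy.
Qed.

Lemma Xreduced_noemit y c : Xreduced (y * s_ c) -> emission y c = None.
Proof.
move=> Dy; apply: emission_None => x [Xx E s]; have := Dy x Xx.
rewrite invgM cox_genV rsignM -(rsign_conj E) s rsign_gen -E invgK.
by rewrite !mulgA mulVg mul1g mulgVK eqxx.
Qed.

(** The flag [b] selects the inverse step; both agree on a move, as [s_ c] is an involution. Pairs
    with [p.1] not reduced are fixed, which makes the step a bijection of all pairs. *)
Definition retr_step (b : bool) c (p : W * A) : W * A :=
  if `[< Xreduced p.1 >] then
    if emission p.1 c is Some x then
      (p.1, (if b then (d_ x)^-1 else d_ x) * p.2)
    else (p.1 * s_ c, p.2)
  else p.

Lemma retr_stepK b c : cancel (retr_step b c) (retr_step (~~ b) c).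
Proof.
case=> y h; rewrite /retr_step; have [Dy|nDy] := pselect (Xreduced y).
  rewrite [`[< Xreduced (y, h).1 >]]asboolT //=; case e: (emission y c) => [x|] /=.
    by rewrite asboolT // e; case: b; rewrite /= ?mulKg ?mulVKg.
  rewrite asboolT; last exact: Xreduced_move.
  by rewrite emission_move // -mulgA cox_gen_sq mulg1.
by rewrite [`[< Xreduced (y, h).1 >]]asboolF //= asboolF.
Qed.

Definition retr_sym c := Symg (retr_stepK false c) (retr_stepK true c).

Lemma retr_sym_move y c h : Xreduced y -> emission y c = None ->
  retr_sym c (y, h) = (y * s_ c, h).
Proof. by move=> Dy e; rewrite /= /retr_step asboolT //= e. Qed.

Lemma retr_sym_emit y c x h : Xreduced y -> emission y c = Some x ->
  retr_sym c (y, h) = (y, d_ x * h).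
Proof. by move=> Dy e; rewrite /= /retr_step asboolT //= e. Qed.

(** * Braid relations for the action, on one coset of a dihedral parabolic subgroup *)

Section Braid.
Variables (i j : S) (k : nat) (y0 : W).
Let Y : pred S := pred2 i j.
Hypotheses (nij : i != j) (mij : m i j = Some k).
Hypothesis y0_min : forall v, all Y v -> clen y0 <= clen (y0 * wprod m v).

Let k2 : 1 < k. Proof. exact: cox_offdiag nij mij. Qed.

(** Removing the last letter is a step by [c]. It shortens the element, whereas an emission at [c]
    requires [alpha_c] to stay positive, so the step is a move. *)
Lemma Xreduced_prefix u c : min_word m Y (rcons u c) ->
  Xreduced (y0 * wprod m (rcons u c)) -> Xreduced (y0 * wprod m u).
Proof.
move=> mu Dy.
have E : y0 * wprod m u = y0 * wprod m (rcons u c) * s_ c.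
  by rewrite wprod_rcons -!mulgA cox_gen_sq mulg1.
rewrite E; apply: Xreduced_move => //; apply: emission_None => x [_ _ /negbT].
move=> /clen_gt; rewrite -E (clen_coset y0_min mu).
by rewrite (clen_coset y0_min (min_word_prefix mu)) size_rcons; lia.
Qed.

Lemma Xreduced_y0 u : min_word m Y u -> Xreduced (y0 * wprod m u) -> Xreduced y0.
Proof.
elim/last_ind: u => [|u c IHu] mu; first by rewrite wprod_nil mulg1.
by move/(Xreduced_prefix mu); apply: IHu; apply: min_word_prefix mu.
Qed.

(** With [r] the reflection [v s_c v^-1], the element [y0 r = s_x y0] is at most one letter longer
    than [y0]; by additivity of lengths [r] is a single generator. *)
Lemma emission_coset v c x : all Y v -> Y c ->
  emission (y0 * wprod m v) c = Some x ->
  exists b, [/\ Y b, wprod m v * s_ c * (wprod m v)^-1 = s_ b &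
                emission y0 b = Some x].
Proof.
move=> Yv Yc /emission_Some[Xx E sx].
have Yw : all Y (v ++ c :: rev v) by rewrite all_cat /= all_rev Yv Yc.
have [u Eu mu] := min_wordP m Yw.
have rV : (wprod m v)^-1 = wprod m (rev v) by apply/mulg1_eq/wprod_mulrev.
have Er : wprod m u = wprod m v * s_ c * (wprod m v)^-1.
  by rewrite Eu wprod_cat wprod_cons rV mulgA.
have Ex : y0 * wprod m u = s_ x * y0.
  by rewrite Er -E invgM !mulgA mulgVK.
have := clen_genmul y0 x; rewrite -Ex (clen_coset y0_min mu).
case: u Eu mu Er Ex => [|b [|b' u]] Eu mu Er Ex; last by rewrite /=; lia.
  move: Er; rewrite wprod_nil => /esym/(congr1 (fun z => (wprod m v)^-1 * z * wprod m v)).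
  rewrite !mulgA mulVg mul1g mulgVK mulg1 mulVg => c1.
  by have := cox_gen_neq1 m c; rewrite c1 eqxx.
move=> _; exists b; have Yb : Y b by case: mu => /= /andP[].
have wb : wprod m [:: b] = s_ b by rewrite wprod_cons wprod_nil mulg1.
split=> //; first by rewrite -Er.
apply/emission_Some; split=> //; first by rewrite -wb Ex mulgK.
apply/negP => /clen_lt; rewrite -wb (clen_coset y0_min mu) /=; lia.
Qed.

Lemma retr_braid_none u h : min_word m Y u -> Xreduced (y0 * wprod m u) ->
  emission y0 i = None -> emission y0 j = None ->
  altprod (retr_sym i) (retr_sym j) k (y0 * wprod m u, h) =
  altprod (retr_sym j) (retr_sym i) k (y0 * wprod m u, h).
Proof.
move=> mu Du ei ej.
(* By [emission_coset] nothing is emitted on this coset: the letters only move the state, and the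
   braid relation of [W] applies. *)
have walk p a b v : Y a -> Y b -> all Y v -> Xreduced (y0 * wprod m v) ->
    altprod (retr_sym a) (retr_sym b) p (y0 * wprod m v, h) =
    (y0 * wprod m v * (altprod (s_ a) (s_ b) p)^-1, h).
  elim: p a b v => [|p IHp] a b v Ya Yb Yv Dv; first by rewrite invg1 mulg1.
  have e : emission (y0 * wprod m v) a = None.
    case e: emission => [x|//]; have [c [/orP[] /eqP->]] := emission_coset Yv Ya e.
      by rewrite ei.
    by rewrite ej.
  rewrite [altprod _ _ _]/= symgME retr_sym_move //.
  rewrite -mulgA -wprod_rcons IHp //; last 2 first.
  - by rewrite all_rcons Ya.
  - by rewrite wprod_rcons mulgA; apply: Xreduced_move.
  by rewrite [altprod (s_ a) _ _]/= invgM cox_genV wprod_rcons !mulgA.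
have Yi : Y i by rewrite /Y /= eqxx.
have Yj : Y j by rewrite /Y /= eqxx orbT.
by rewrite !walk ?(cox_gen_braid nij mij) //; case: mu.
Qed.

Lemma emission_order x y : emission y0 i = Some x -> emission y0 j = Some y ->
  x != y /\ m x y = Some k.
Proof.
move=> /emission_Some[_ Ex _] /emission_Some[_ Ey _].
exact: cox_conj_order Ex Ey nij mij.
Qed.

(** Here [y0] is the only reduced state of its coset; it never moves, and the braid relation of
    [d_ x] and [d_ y] applies. *)
Lemma retr_braid_both x y u h : min_word m Y u -> Xreduced (y0 * wprod m u) ->
  emission y0 i = Some x -> emission y0 j = Some y ->
  altprod (retr_sym i) (retr_sym j) k (y0 * wprod m u, h) =
  altprod (retr_sym j) (retr_sym i) k (y0 * wprod m u, h).
Proof.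
move=> mu Du ei ej; have Dy := Xreduced_y0 mu Du.
have [nxy mxy] := emission_order ei ej.
have {mu Du}-> : u = [::].
  elim/last_ind: u mu Du => [//|u c IHu] mu Du.
  have u0 := IHu (min_word_prefix mu) (Xreduced_prefix mu Du); subst u.
  move: Du; rewrite /= wprod_cons wprod_nil mulg1 => /Xreduced_noemit.
  by case: mu => /= /andP[/orP[]/eqP-> _ _]; rewrite ?ei ?ej.
rewrite wprod_nil mulg1.
have walk p a b c d : emission y0 a = Some c -> emission y0 b = Some d ->
    altprod (retr_sym a) (retr_sym b) p (y0, h) = (y0, altprod (d_ c) (d_ d) p * h).
  elim: p a b c d h => [|p IHp] a b c d g ea eb; first by rewrite mul1g.
  by rewrite [altprod _ _ _]/= symgME (retr_sym_emit _ Dy ea) (IHp b a d c) //= -mulgA.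
by rewrite (walk k _ _ _ _ ei ej) (walk k _ _ _ _ ej ei) (artin_gen_braid nxy mxy).
Qed.

Section OneEmission.
Variable x : S.
Hypotheses (ei : emission y0 i = Some x) (ej : emission y0 j = None).
Hypothesis Dy0 : Xreduced y0.

(** The state [y0 * v p] is reached from [y0] by the letters [e 0 = j], [e 1 = i], and so on; the
    first is [j] because [i] emits at [y0]. *)
Let e n := if odd n then i else j.
Let v p : W := (altprod (s_ j) (s_ i) p)^-1.

Let Ye n : Y (e n).
Proof. by rewrite /Y /e /=; case: (odd n); rewrite eqxx ?orbT. Qed.

Let vS p : v p.+1 = v p * s_ (e p).
Proof.
by rewrite /v altprodSl invgM /e; case: (odd p); rewrite cox_genV.
Qed.

Let v_word p : v p = wprod m (mkseq e p) /\ all Y (mkseq e p).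
Proof.
elim: p => [|p [IH1 IH2]]; first by rewrite wprod_nil /v invg1.
have -> : mkseq e p.+1 = rcons (mkseq e p) (e p).
  by rewrite /mkseq -addn1 iotaD map_cat cats1.
by rewrite wprod_rcons vS IH1 all_rcons Ye.
Qed.

Let v_refl p : v p * s_ (e p) * (v p)^-1 = s_ i -> k %| p.+1.
Proof.
rewrite -vS => E; have {}E : v p.+1 = s_ i * v p by rewrite -E mulgVK.
have : altprod (s_ j) (s_ i) p.+1 = altprod (s_ i) (s_ j) p.+1.
  by apply: invg_inj; rewrite [LHS]E /= invgM cox_genV.
move/altprodP => /(_ (cox_gen_sq _ _) (cox_gen_sq _ _)).
have nji : j != i by rewrite eq_sym.
move/(cox_gen_order nji (ltn0Sn p)) => [k'].
by rewrite cox_sym mij => -[<-].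
Qed.

Let no_emission p : p.+1 < k -> emission (y0 * v p) (e p) = None.
Proof.
move=> pk; have [Ev Yv] := v_word p.
case E: emission => [z|//]; move: E; rewrite {1}Ev.
move=> /(emission_coset Yv (Ye p))[b [/orP[] /eqP->]]; last by rewrite ej.
by rewrite -Ev => /v_refl /(dvdn_leq (ltn0Sn p)); lia.
Qed.

Let Dv p : p < k -> Xreduced (y0 * v p).
Proof.
elim: p => [|p IHp] pk; first by rewrite /v invg1 mulg1.
by rewrite vS mulgA; apply: Xreduced_move; [apply: IHp; lia | apply: no_emission].
Qed.

(** The braid relation gives [v k = s_ i * v p], so [v p] conjugates the next letter to [s_ i],
    which [y0] conjugates to [s_ x]. *)
Let end_emission p : p.+1 = k -> emission (y0 * v p) (e p) = Some x.
Proof.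
move=> pk; have /emission_Some[Xx Ex _] := ei.
have E : v p * s_ (e p) * (v p)^-1 = s_ i.
  rewrite -vS /v pk -(cox_gen_braid nij mij) -pk /= invgM cox_genV.
  by rewrite invgK mulgVK.
have {}E : y0 * v p * s_ (e p) * (y0 * v p)^-1 = s_ x.
  by rewrite invgM -Ex -E !mulgA.
by apply/emission_Some; split=> //; rewrite (rsign_conj E) Dv // -pk.
Qed.

(* The states met when reading alternately [j], [i], [j], ... from [y0]: they
   run up from [0] to [k - 1], where [d_ x] is emitted, and back down to [0],
   where [d_ x] is emitted again. *)
Let pos n := let r := n %% k.*2 in if r < k then r else k.*2.-1 - r.

Let e_mod n : e n = e (n %% k.*2).
Proof. by rewrite /e {1}(divn_eq n k.*2) oddD oddM odd_double andbF. Qed.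

Let step n h : retr_sym (e n) (y0 * v (pos n), h) =
  (y0 * v (pos n.+1), (if k %| n.+1 then d_ x else 1) * h).
Proof.
have k0 : 0 < k.*2 by lia.
have dk : (k %| n.+1) = (k %| (n %% k.*2).+1).
  by rewrite {1}(divn_eq n k.*2) -addnS dvdn_addr // -mul2n mulnA dvdn_mull.
have ps : pos n.+1 = pos (n %% k.*2).+1.
  by rewrite /pos -[n.+1]addn1 -modnDml addn1.
have pm : pos n = pos (n %% k.*2) by rewrite /pos modn_mod.
rewrite e_mod dk ps pm; move: (ltn_pmod n k0).
move: (n %% k.*2) => {dk ps pm}r rk.
(* In order: the way up; the way down, with an emission at [r = 2k - 1]; the emission at
   [r = k - 1]. *)
have [rk1|rk1|rk1] := ltngtP r.+1 k.
- have -> : pos r = r by rewrite /pos modn_small //; case: ltnP => //; lia.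
  have -> : pos r.+1 = r.+1 by rewrite /pos modn_small ?rk1 //; lia.
  rewrite retr_sym_move ?no_emission //; last by apply: Dv; lia.
  by rewrite vS mulgA gtnNdvd // mul1g.
- have -> : pos r = k.*2.-1 - r by rewrite /pos modn_small //; case: ltnP => //; lia.
  have [rk2|rk2] := eqVneq r.+1 k.*2.
    have -> : pos r.+1 = 0 by rewrite /pos rk2 modnn; case: ltnP => //; lia.
    have -> : k.*2.-1 - r = 0 by lia.
    rewrite rk2 -mul2n dvdn_mull // /v invg1 mulg1.
    have -> : e r = i.
      have : odd r by have := congr1 odd rk2; rewrite /= odd_double => /negbFE.
      by rewrite /e => ->.
    by rewrite (retr_sym_emit _ _ ei).
  have [p Ep] : exists p, k.*2.-1 - r = p.+1 by exists (k.*2.-1 - r).-1; lia.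
  have -> : pos r.+1 = p by rewrite /pos modn_small; [case: ltnP|]; lia.
  have -> : e r = e p.
    have : odd (k.*2.-1 - r + r) by rewrite subnK; [rewrite -subn1 oddB ?odd_double|]; lia.
    by rewrite Ep oddD /e /=; case: (odd p); case: (odd r).
  have Dp : Xreduced (y0 * v p) by apply: Dv; lia.
  have Dp1 : Xreduced (y0 * v p * s_ (e p)) by rewrite -mulgA -vS; apply: Dv; lia.
  rewrite Ep vS mulgA retr_sym_move ?emission_move //.
  rewrite -[_ * s_ _ * s_ _]mulgA cox_gen_sq mulg1 (_ : k %| r.+1 = false) ?mul1g //.
  apply/negP => /dvdnP[q Eq]; have : q = 1%N by nia.
  lia.
- have -> : pos r = r by rewrite /pos modn_small //; case: ltnP => //; lia.
  have -> : pos r.+1 = r by rewrite /pos modn_small; [case: ltnP|]; lia.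
  by rewrite (retr_sym_emit _ _ (end_emission rk1)) ?rk1 ?dvdnn //; apply: Dv; lia.
Qed.

(** The exponent counts the multiples of [k] from [n + 1] to [n + t]. *)
Let walk n t h :
  altprod (retr_sym (e n)) (retr_sym (e n.+1)) t (y0 * v (pos n), h) =
  (y0 * v (pos (n + t)), d_ x ^+ ((n + t) %/ k - n %/ k) * h).
Proof.
elim: t => [|t IHt]; first by rewrite addn0 subnn mul1g.
rewrite altprodSl symgME IHt.
have -> : (if odd t then retr_sym (e n.+1) else retr_sym (e n)) = retr_sym (e (n + t)).
  by rewrite /e oddD /=; case: (odd t); case: (odd n).
rewrite step addnS; congr pair; rewrite mulgA; congr (_ * _).
have le : n %/ k <= (n + t) %/ k by apply: leq_div2r; lia.
rewrite divnS; last by lia.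
by case: (k %| _); rewrite ?add1n ?add0n ?subSn // ?expgS ?mul1g.
Qed.

(** All prefixes of [u] are reduced states. A letter other than the expected [e p] is either the
    emitting [i] at [y0] or undoes the previous letter; at [p = k - 1] the letter [e p] emits. *)
Let v_inj_word u : min_word m Y u -> Xreduced (y0 * wprod m u) ->
  wprod m u = v (size u) /\ size u < k.
Proof.
elim/last_ind: u => [|u c IHu] mu Du.
  by rewrite wprod_nil /v invg1; split=> //; apply: ltnW k2.
have [Eu su] := IHu (min_word_prefix mu) (Xreduced_prefix mu Du).
have [/[!all_rcons]/andP[Yc Yu] umin] := mu.
have noc : emission (y0 * v (size u)) c = None.
  by apply: Xreduced_noemit; rewrite -Eu -mulgA -wprod_rcons.
rewrite size_rcons; have [Ec|nEc] := eqVneq c (e (size u)).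
  rewrite wprod_rcons Eu vS Ec; split=> //; rewrite ltn_neqAle su andbT.
  by apply/negP => /eqP/end_emission; rewrite -Ec noc.
have {nEc} Ec : c = e (size u).+1.
  by move: Yc nEc; rewrite /Y /e /=; case: (odd _) => /orP[] /eqP->; rewrite ?eqxx.
case sp: (size u) Eu noc Ec => [|p] Eu noc Ec.
  by move: noc; rewrite Ec /v /= invg1 mulg1 ei.
have [Ep Yp] := v_word p.
have := umin (mkseq e p) Yp; rewrite -Ep wprod_rcons Eu Ec vS -mulgA.
rewrite (_ : e p.+2 = e p) ?cox_gen_sq ?mulg1; last by rewrite /e /= negbK.
by move=> /(_ erefl); rewrite size_rcons size_mkseq sp; lia.
Qed.

(** The state [p] occurs at time [p], on the way up, and at time [2k - 1 - p], on the way down.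
    These times have opposite parities, so the two sides of the relation are the [k] steps from
    each; both cross one emission and end in state [k - 1 - p]. *)
Lemma retr_braid_one u h : min_word m Y u -> Xreduced (y0 * wprod m u) ->
  altprod (retr_sym i) (retr_sym j) k (y0 * wprod m u, h) =
  altprod (retr_sym j) (retr_sym i) k (y0 * wprod m u, h).
Proof.
move=> mu Du; have [-> pk] := v_inj_word mu Du; move: (size u) pk => p pk.
have up : pos p = p by rewrite /pos modn_small ?pk //; lia.
pose q := k.*2.-1 - p.
have down : pos q = p by rewrite /pos modn_small /q; [case: ltnP|]; lia.
have Eup := walk p k h; have Edown := walk q k h.
rewrite up in Eup; rewrite down in Edown.
have E1 n : (n + k) %/ k - n %/ k = 1%N.
  by rewrite divnDr ?dvdnn // divnn (_ : 0 < k) ?addKn //; lia.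
rewrite !E1 expg1 in Eup Edown.
have pq : pos (p + k) = pos (q + k).
  have -> : q + k = k.-1 - p + k.*2 by rewrite /q; lia.
  rewrite /pos modnDr modn_small; last by lia.
  rewrite (modn_small (m := k.-1 - p)); last by lia.
  by case: ltnP; case: ltnP; lia.
have oq : odd q = ~~ odd p.
  have : odd (q + p) by rewrite /q subnK; [rewrite -subn1 oddB ?odd_double|]; lia.
  by rewrite oddD; case: (odd p); case: (odd q).
move: Eup Edown; rewrite {}pq /e /= oq.
by case: (odd p) => /= -> ->.
Qed.

End OneEmission.
End Braid.

Lemma retr_braid i j k : i != j -> m i j = Some k ->
  altprod (retr_sym i) (retr_sym j) k = altprod (retr_sym j) (retr_sym i) k.
Proof.
move=> nij mij; apply: symg_ext => -[y h].
have [Dy|nDy] := pselect (Xreduced y); last first.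
  have fix_ c : retr_sym c (y, h) = (y, h) by rewrite /= /retr_step asboolF.
  have fixa n a b : altprod (retr_sym a) (retr_sym b) n (y, h) = (y, h).
    by elim: n a b => [//|n IHn] a b; rewrite [altprod _ _ _]/= symgME fix_ IHn.
  by rewrite !fixa.
have [y0 [u [ymin mu Ey]]] := coset_decomp (pred2 i j) y; subst y.
have Dy0 := Xreduced_y0 nij mij ymin mu Dy.
have Yji : pred2 j i =1 pred2 i j by move=> c /=; rewrite orbC.
case ei: (emission y0 i) => [x|]; case ej: (emission y0 j) => [x'|].
- exact: retr_braid_both ei ej.
- exact: retr_braid_one ei ej _ _ _ _ _.
- apply/esym; apply: retr_braid_one ej ei _ _ _ _ _ => //.
  + by rewrite eq_sym.
  + by rewrite cox_sym.
  + by move=> v; rewrite (eq_all Yji); apply: ymin.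
  case: mu => Yu umin; split; first by rewrite (eq_all Yji).
  by move=> v; rewrite (eq_all Yji); apply: umin.
- exact: retr_braid_none ei ej.
Qed.

Definition retr : A -> symg (W * A) := artin_lift retr_sym.

Lemma retrM : {morph retr : a b / a * b}.
Proof. exact: artin_liftM retr_braid. Qed.

Lemma retrV : {morph retr : a / a^-1}.
Proof. exact: artin_liftV retr_braid. Qed.

Lemma retr_gen i : retr (artin_gen m i) = retr_sym i.
Proof. exact: artin_lift_gen retr_braid i. Qed.

(** The state 1 emits [x] at every [x] in [X], so it never changes and the letters of [a] are
    copied. *)
Lemma retr_parabolic a h : gen_by d_ X a -> retr a (1, h) = (1, a * h).
Proof.
have st b x g : X x -> retr_step b x (1, g) = (1, (if b then (d_ x)^-1 else d_ x) * g).
  move=> Xx; rewrite /retr_step asboolT; last exact: Xreduced1.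
  rewrite (_ : emission _ _ = Some x) //; apply/emission_Some.
  by split; rewrite ?rsign1 // mul1g invg1 mulg1.
elim=> [|x b Xx _ IH|x b Xx _ IH].
- by rewrite /retr (artin_lift1 retr_braid) mul1g.
- by rewrite retrM symgME IH retr_gen /= st // mulgA.
- by rewrite retrM symgME IH retrV retr_gen /= st // mulgA.
Qed.

(** An emitted [x] has [s_ x = y * s_ c * y^-1] in [W_F], hence lies in [F] by [gen_by_cox_gen]. *)
Lemma retr_gen_by (F : S -> Prop) a y h : gen_by d_ F a ->
  gen_by s_ F y -> gen_by d_ (fun i => F i /\ X i) h ->
  gen_by s_ F (retr a (y, h)).1 /\
  gen_by d_ (fun i => F i /\ X i) (retr a (y, h)).2.
Proof.
move=> + gy gh; have st b c p : F c ->
    gen_by s_ F p.1 /\ gen_by d_ (fun i => F i /\ X i) p.2 ->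
    gen_by s_ F (retr_step b c p).1 /\
    gen_by d_ (fun i => F i /\ X i) (retr_step b c p).2.
  case: p => z g Fc [/= gz gg]; rewrite /retr_step; case: asboolP => // _ /=.
  case e: (emission z c) => [x|] /=; split=> //; last first.
    by apply: gen_byM => //; apply: gen_by_gen.
  have [Xx Ex _] := (emission_Some _ _ _).1 e.
  have Fx : F x.
    apply: (@gen_by_cox_gen _ m); rewrite -Ex.
    by apply: gen_byM (gen_byV gz); apply: gen_byM => //; apply: gen_by_gen.
  by apply: gen_byM => //; case: b; [apply: gen_by_genV | apply: gen_by_gen].
elim=> [|c b Fc _ IH|c b Fc _ IH].
- by rewrite /retr (artin_lift1 retr_braid).
- by rewrite retrM symgME retr_gen; apply: st.
- by rewrite retrM symgME retrV retr_gen; apply: (st true).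
Qed.

Lemma parabolicI (F : S -> Prop) a :
  gen_by d_ X a -> gen_by d_ F a -> gen_by d_ (fun i => F i /\ X i) a.
Proof.
move=> Xa Fa; have [_] := retr_gen_by Fa (gen_by1 _ _) (gen_by1 _ _).
by rewrite retr_parabolic // mulg1.
Qed.

End Retraction.

(** * Normal forms for amalgamated products *)

Section NormalForm.
Variables (G : groupType) (P : bool -> G -> Prop).
Hypotheses (P1 : forall b, P b 1) (PM : forall b x y, P b x -> P b y -> P b (x * y)).
Hypothesis PV : forall b x, P b x -> P b x^-1.

(** The subgroup [C] along which [P true] and [P false] are amalgamated. *)
Definition amal x := forall b, P b x.

Lemma amal1 : amal 1. Proof. by move=> b. Qed.
Lemma amalM x y : amal x -> amal y -> amal (x * y).
Proof. by move=> Cx Cy b; apply: PM. Qed.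
Lemma amalV x : amal x -> amal x^-1.
Proof. by move=> Cx b; apply: PV. Qed.

Lemma amalE b x : P b x -> P (~~ b) x -> amal x.
Proof. by case: b => h1 h2 []. Qed.

(** The choice is made from the coset [x C] as a set, hence depends on that coset only; [C] itself
    is represented by 1. *)
Definition cosrep x : G :=
  if `[< amal x >] then 1 else xget 1 [set z | amal (x^-1 * z)]%classic.

Lemma cosrep_amal x : amal (x^-1 * cosrep x).
Proof.
rewrite /cosrep; case: asboolP => Cx; first by rewrite mulg1; apply: amalV.
apply: (@xgetPex _ 1 [set z | amal (x^-1 * z)]%classic).
by exists x; rewrite /= mulVg; apply: amal1.
Qed.

Lemma cosrepM x c : amal c -> cosrep (x * c) = cosrep x.
Proof.
move=> Cc; rewrite /cosrep.
have -> : `[< amal (x * c) >] = `[< amal x >].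
  apply/asboolP/asboolP => h; last exact: amalM.
  by rewrite -(mulgK c x); apply: amalM h (amalV Cc).
congr (if _ then _ else xget _ _); apply: funext => z; apply: propext.
rewrite /= invgM -mulgA; split=> h; last exact: amalM (amalV Cc) h.
by rewrite -(mulVKg c (x^-1 * z)); apply: amalM.
Qed.

Lemma cosrepK x : cosrep (cosrep x) = cosrep x.
Proof. by rewrite -{1}(mulVKg x (cosrep x)) cosrepM //; apply: cosrep_amal. Qed.

Lemma cosrepE x : exists2 c, amal c & x = cosrep x * c.
Proof.
exists ((cosrep x)^-1 * x); last by rewrite mulVKg.
by rewrite -[_ * x]invgK invgM invgK; apply/amalV/cosrep_amal.
Qed.

Lemma amal_cosrepV x : amal ((cosrep x)^-1 * x).
Proof. by have [c Cc {2}->] := cosrepE x; rewrite mulKg. Qed.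

Lemma cosrepP b x : P b (cosrep x) <-> P b x.
Proof.
have [c Cc E] := cosrepE x; split=> [h|h]; first by rewrite E; apply: PM.
have -> : cosrep x = x * c^-1 by rewrite {2}E mulgK.
by apply: PM => //; apply: PV.
Qed.

(** The letters alternate between the sides, starting with side [b]. The last factor, in [C], is
    left out: a list stands for a coset of [C], not for an element. *)
Fixpoint reduced b (l : seq G) : Prop :=
  if l is t :: l' then
    [/\ P b t, ~ P (~~ b) t, cosrep t = t & reduced (~~ b) l']
  else True.

Definition nform l := exists b, reduced b l.

(** The factor [c] is pushed rightwards through the list, renewing each representative, and what
    remains at the end is dropped. *)
Fixpoint amal_act c (l : seq G) : seq G :=
  if l is t :: l' then cosrep (c * t) :: amal_act ((cosrep (c * t))^-1 * (c * t)) l'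
  else [::].

Definition nfcons q l :=
  if `[< amal q >] then amal_act q l else cosrep q :: amal_act ((cosrep q)^-1 * q) l.

(** Splits off the leading factor in [P b], or 1 if there is none, so that [P b] can act on it by
    multiplication. *)
Definition nfhead b l : G * seq G :=
  if l is t :: l' then if `[< P b t >] then (t, l') else (1, l) else (1, [::]).

Definition nfact b p l := let h := nfhead b l in nfcons (p * h.1) h.2.

Notation prodl l := (\prod_(t <- l) t).

Lemma amal_act_reduced c b l : amal c -> reduced b l -> reduced b (amal_act c l).
Proof.
elim: l b c => //= t l IHl b c Cc [Pt nPt rt rl]; split.
- by apply/cosrepP/PM.
- by move=> /cosrepP h; apply: nPt; rewrite -(mulKg c t); apply: PM => //; apply: PV.
- exact: cosrepK.
- by apply: IHl rl; apply: amal_cosrepV.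
Qed.

Lemma amal_act1 b l : reduced b l -> amal_act 1 l = l.
Proof.
by elim: l b => //= t l IHl b [_ _ rt /IHl E]; rewrite mul1g rt mulVg E.
Qed.

Lemma amal_actM c d l : amal c -> amal d ->
  amal_act (c * d) l = amal_act c (amal_act d l).
Proof.
elim: l c d => //= t l IHl c d Cc Cd.
have E : cosrep (c * cosrep (d * t)) = cosrep (c * d * t).
  rewrite -[c * d * t]mulgA -[in RHS](mulVKg (cosrep (d * t)) (d * t)) mulgA.
  by rewrite [RHS]cosrepM //; apply: amal_cosrepV.
rewrite -IHl; [|exact: amal_cosrepV..].
by rewrite E; congr (_ :: amal_act _ _); rewrite -!mulgA mulVKg.
Qed.

Lemma amal_act_size c l : size (amal_act c l) = size l.
Proof. by elim: l c => //= t l IHl c; rewrite IHl. Qed.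

Lemma amal_act_prod c l : amal c ->
  amal ((prodl (amal_act c l))^-1 * (c * prodl l)).
Proof.
elim: l c => [|t l IHl] c Cc; first by rewrite !big_nil invg1 mul1g mulg1.
have := IHl _ (amal_cosrepV (c * t)).
by rewrite /= !big_cons invgM -!mulgA.
Qed.

Lemma nfcons_prod q l : amal ((prodl (nfcons q l))^-1 * (q * prodl l)).
Proof.
rewrite /nfcons; case: asboolP => Cq; first exact: amal_act_prod.
have := amal_act_prod l (amal_cosrepV q).
by rewrite big_cons invgM -!mulgA.
Qed.

Lemma nfconsM q c l : amal c -> nfcons (q * c) l = nfcons q (amal_act c l).
Proof.
move=> Cc; rewrite /nfcons.
have -> : `[< amal (q * c) >] = `[< amal q >].
  apply/asboolP/asboolP => h; last exact: amalM.
  by rewrite -(mulgK c q); apply: amalM h (amalV Cc).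
case: asboolP => Cq; first by rewrite amal_actM.
by rewrite cosrepM // mulgA amal_actM //; apply: amal_cosrepV.
Qed.

Lemma nfcons1 b l : reduced b l -> nfcons 1 l = l.
Proof. by rewrite /nfcons asboolT; [apply: amal_act1 | apply: amal1]. Qed.

Lemma nfcons_notin b q l : P b q -> ~ P (~~ b) q -> reduced (~~ b) l ->
  nfcons q l = cosrep q :: amal_act ((cosrep q)^-1 * q) l /\ reduced b (nfcons q l).
Proof.
move=> Pq nPq rl; have E : nfcons q l = cosrep q :: amal_act ((cosrep q)^-1 * q) l.
  by rewrite /nfcons asboolF // => Cq; apply: nPq.
rewrite E; split=> //=; split; rewrite ?cosrepK ?cosrepP //.
by apply: amal_act_reduced rl; apply: amal_cosrepV.
Qed.

Lemma nfcons_nform b q l : P b q -> reduced (~~ b) l -> nform (nfcons q l).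
Proof.
move=> Pq rl; have [nPq|nPq] := pselect (P (~~ b) q).
  have Cq := amalE Pq nPq; exists (~~ b).
  by rewrite /nfcons asboolT //; apply: amal_act_reduced.
by exists b; have [] := nfcons_notin Pq nPq rl.
Qed.

Lemma nfheadP b l : nform l -> let h := nfhead b l in
  [/\ P b h.1, reduced (~~ b) h.2, nfcons h.1 h.2 = l & prodl l = h.1 * prodl h.2].
Proof.
case: l => [|t l] [b' rl] /=.
  by split=> //; rewrite ?(@nfcons1 b) // big_nil mulg1.
have [Pt|nPt] := pselect (P b t).
  rewrite asboolT //=; case: rl => Pbt nPt rt rl.
  have Eb : b' = b by move: nPt Pbt Pt; case: (b) (b') => -[].
  rewrite Eb in Pbt nPt rl; split=> //; last by rewrite big_cons.
  by have [-> _] := nfcons_notin Pbt nPt rl; rewrite rt mulVg (amal_act1 rl).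
rewrite asboolF //=; split=> //; last by rewrite mul1g.
  by case: rl => Pbt nPbt rt rl; move: Pbt nPbt rl nPt; case: (b) (b') => -[].
exact: (@nfcons1 b').
Qed.

Lemma nfact_nfcons b p q l : P b p -> P b q -> reduced (~~ b) l ->
  nfact b p (nfcons q l) = nfcons (p * q) l.
Proof.
move=> Pp Pq rl; have [nPq|nPq] := pselect (P (~~ b) q).
  have Cq := amalE Pq nPq.
  rewrite [in LHS]/nfcons asboolT // nfconsM //.
  have := amal_act_reduced Cq rl; rewrite /nfact.
  case: (amal_act q l) => [|t l'] /=; first by rewrite mulg1.
  by case=> _; rewrite negbK => nPt _ _; rewrite asboolF //= mulg1.
have [E _] := nfcons_notin Pq nPq rl.
rewrite E /nfact /= asboolT /=; last exact/cosrepP.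
rewrite -nfconsM; last exact: amal_cosrepV.
by rewrite -mulgA mulVKg.
Qed.

Lemma nfact_amal b c l : amal c -> nform l -> nfact b c l = amal_act c l.
Proof.
move=> Cc nl; rewrite /nfact; case: l nl => [|t l] nl /=.
  by rewrite mulg1 /nfcons asboolT.
case: nl => b' nl; have [Pt|nPt] := pselect (P b t).
  rewrite asboolT //= /nfcons asboolF //.
  case: nl => Pt' nPt' _ _ Cct; apply: nPt'.
  by rewrite -(mulKg c t); apply: PM; [apply/PV | apply: Cct].
by rewrite asboolF //= mulg1 /nfcons asboolT.
Qed.

Definition nfmap b p l := if `[< P b p /\ nform l >] then nfact b p l else l.

Lemma nfactM b p q l : P b p -> P b q -> nform l ->
  nform (nfact b q l) /\ nfact b p (nfact b q l) = nfact b (p * q) l.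
Proof.
move=> Pp Pq nl; have [Ph rh Eh _] := nfheadP b nl.
rewrite /nfact -/(nfact b p _); split; first by apply: nfcons_nform rh; apply: PM.
by rewrite nfact_nfcons //; [rewrite mulgA | apply: PM].
Qed.

Lemma nfact1 b l : nform l -> nfact b 1 l = l.
Proof. by move=> nl; have [_ _ + _] := nfheadP b nl; rewrite /nfact mul1g. Qed.

Lemma nfmapK b p : cancel (nfmap b p) (nfmap b p^-1).
Proof.
move=> l; rewrite {2}/nfmap; case: asboolP => [[Pp nl]|h].
  have [n' E] := nfactM (PV Pp) Pp nl.
  by rewrite /nfmap asboolT ?E ?mulVg ?nfact1 //; split=> //; apply: PV.
by rewrite /nfmap asboolF // => -[/PV + nl]; rewrite invgK => Pp; apply: h.
Qed.

Lemma nfmapVK b p : cancel (nfmap b p^-1) (nfmap b p).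
Proof. by move=> l; have := nfmapK b p^-1 l; rewrite invgK. Qed.

Definition nfsym b p := Symg (nfmapK b p) (nfmapVK b p).

Lemma nfsymE b p l : P b p -> nform l -> nfsym b p l = nfact b p l.
Proof. by move=> Pp nl; rewrite /= /nfmap asboolT. Qed.

Lemma nfsym_default b p l : ~ nform l -> nfsym b p l = l.
Proof. by move=> nl; rewrite /= /nfmap asboolF // => -[]. Qed.

Lemma nfsymM b p q : P b p -> P b q -> nfsym b (p * q) = nfsym b p * nfsym b q.
Proof.
move=> Pp Pq; apply: symg_ext => l; rewrite symgME.
have [nl|nl] := pselect (nform l); last by rewrite !nfsym_default.
have [n' E] := nfactM Pp Pq nl.
by rewrite (nfsymE Pq nl) (nfsymE Pp n') E nfsymE //; apply: PM.
Qed.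

Lemma nfsym1 b : nfsym b 1 = 1.
Proof. by apply: (mulgI (nfsym b 1)); rewrite -nfsymM ?mulg1. Qed.

Lemma nfsymV b p : P b p -> nfsym b p^-1 = (nfsym b p)^-1.
Proof.
move=> Pp; apply: (mulgI (nfsym b p)).
by rewrite -nfsymM ?mulgV ?nfsym1 //; apply: PV.
Qed.

(** This compatibility lets the actions of the two sides be glued together. *)
Lemma nfsym_amal b b' c : amal c -> nfsym b c = nfsym b' c.
Proof.
move=> Cc; apply: symg_ext => l.
have [nl|nl] := pselect (nform l); last by rewrite !nfsym_default.
by rewrite !nfsymE // !nfact_amal.
Qed.

Lemma nfsym_altprod b x y n : P b x -> P b y ->
  P b (altprod x y n) /\ altprod (nfsym b x) (nfsym b y) n = nfsym b (altprod x y n).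
Proof.
elim: n x y => [|n IHn] x y Px Py /=; first by rewrite nfsym1.
have [Pa ->] := IHn y x Py Px.
by rewrite nfsymM //; split=> //; apply: PM.
Qed.

Lemma nfsym_new b p l : P b p -> ~ P (~~ b) p -> reduced (~~ b) l ->
  reduced b (nfsym b p l) /\ size (nfsym b p l) = (size l).+1.
Proof.
move=> Pp nPp rl; rewrite nfsymE //; last by exists (~~ b).
rewrite -{1 2}(nfcons1 rl) nfact_nfcons // mulg1.
have [E rE] := nfcons_notin Pp nPp rl; split=> //; by rewrite E /= amal_act_size.
Qed.

Lemma nfsym_old b p l : P b p -> reduced b l -> l != [::] ->
  size (nfsym b p l) <= size l.
Proof.
move=> Pp rl; rewrite nfsymE //; last by exists b.
case: l rl => //= t l [Pt _ _ _] _; rewrite /nfact /= asboolT //=.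
by rewrite /nfcons; case: asboolP => _ /=; rewrite amal_act_size.
Qed.

Lemma reduced_uniq b b' l : l != [::] -> reduced b l -> reduced b' l -> b = b'.
Proof. by case: l => //= t l _; case: b; case: b' => // -[Pt nPt _ _] [Pt' nPt' _ _]. Qed.

Lemma nfsym_cons b t l : reduced b (t :: l) -> nfsym b t l = t :: l.
Proof.
case=> Pt nPt rt rl; rewrite nfsymE //; last by exists (~~ b).
rewrite -{1}(nfcons1 rl) nfact_nfcons // mulg1.
by have [-> _] := nfcons_notin Pt nPt rl; rewrite rt mulVg (amal_act1 rl).
Qed.

(** The witness [e] is the side of the last letter. *)
Lemma reduced_last b l : reduced b l -> l != [::] ->
  exists e, forall t, reduced (~~ e) [:: t] -> reduced b (l ++ [:: t]).
Proof.
elim: l b => // t l IHl b [Pt nPt rt rl] _.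
case: (eqVneq l [::]) rl => [->|nl] rl; first by exists b => t'.
by have [e He] := IHl _ rl nl; exists e => t' /He.
Qed.

Lemma nfsym_prod b p l : P b p -> nform l ->
  nform (nfsym b p l) /\ amal ((prodl (nfsym b p l))^-1 * (p * prodl l)).
Proof.
move=> Pp nl; rewrite nfsymE //; split.
  by have [] := nfactM (P1 b) Pp nl.
have [_ _ _ ->] := nfheadP b nl; rewrite /nfact (mulgA p); exact: nfcons_prod.
Qed.

End NormalForm.

(** * Twisted centralizers in Artin groups *)

Section InfinitePair.
Variables (S : countType) (m : coxeterMatrix S) (i0 i1 : S).
Hypotheses (n01 : i0 != i1) (m01 : m i0 i1 = None).
Notation A := (artin m).
Notation d_ := (artin_gen m).

Let ii (b : bool) := if b then i0 else i1.
(** Of the two sides, the generator of [ii b] lies in [P b] only; all generators outside the pair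
    lie in both. *)
Let P b : A -> Prop := gen_by d_ (fun c => c != ii (~~ b)).

Let P1 b : P b 1. Proof. exact: gen_by1. Qed.
Let PM b x y : P b x -> P b y -> P b (x * y). Proof. exact: gen_byM. Qed.
Let PV b x : P b x -> P b x^-1. Proof. exact: gen_byV. Qed.

Lemma artin_gen_notin i : ~ gen_by d_ (fun c => c != i) (d_ i).
Proof.
pose q : A -> coxeter_group m := artin_lift (cox_gen m).
have qM : {morph q : a b / a * b} by apply: artin_liftM; apply: cox_gen_braid.
have qg c : q (d_ c) = cox_gen m c by apply: artin_lift_gen; apply: cox_gen_braid.
have [q1 qV] := morphV1 qM.
have gq Y a : gen_by d_ Y a -> gen_by (cox_gen m) Y (q a).
  elim=> [|c b Yc _ IH|c b Yc _ IH]; rewrite ?q1 ?qM ?qV ?qg; first exact: gen_by1.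
    exact: gen_byS.
  exact: gen_bySV.
by move=> /gq; rewrite qg => /gen_by_cox_gen; rewrite eqxx.
Qed.

Let iiN b : ii b != ii (~~ b).
Proof. by case: b => //=; rewrite eq_sym. Qed.

Let Pii b : P b (d_ (ii b)) /\ ~ P (~~ b) (d_ (ii b)).
Proof. by split; [apply: gen_by_gen; apply: iiN | rewrite /P negbK; apply: artin_gen_notin]. Qed.

Let f c := nfsym P1 PM PV (c != i1) (d_ c).

Let fE b c : c != ii (~~ b) -> f c = nfsym P1 PM PV b (d_ c).
Proof.
rewrite /f; case: b => /= [->//|c0]; have [->//|c1] := eqVneq c i1.
by apply: nfsym_amal => -[]; apply: gen_by_gen.
Qed.

Let f_braid i j k : i != j -> m i j = Some k ->
  altprod (f i) (f j) k = altprod (f j) (f i) k.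
Proof.
(* Since no relation joins [i0] to [i1], the letters [i] and [j] lie in a common side, which
   satisfies the relation. *)
move=> nij mij; suff [b [ib jb]] : exists b, i != ii (~~ b) /\ j != ii (~~ b).
  have Pi : P b (d_ i) by apply: gen_by_gen.
  have Pj : P b (d_ j) by apply: gen_by_gen.
  rewrite (fE ib) (fE jb) (nfsym_altprod P1 PM PV k Pi Pj).2.
  by rewrite (nfsym_altprod P1 PM PV k Pj Pi).2 (artin_gen_braid nij mij).
have [ei|ni] := eqVneq i i1.
  exists false; rewrite ei eq_sym n01; split=> //; apply/eqP => ej.
  by move: mij; rewrite ei ej cox_sym m01.
have [ej|nj] := eqVneq j i1; last by exists true.
exists false; rewrite ej [i1 == _]eq_sym n01; split=> //; apply/eqP => ei.
by move: mij; rewrite ei ej m01.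
Qed.

Let psi : A -> symg (seq A) := artin_lift f.

Let psiM : {morph psi : a b / a * b}. Proof. exact: artin_liftM f_braid. Qed.
Let psi1 : psi 1 = 1. Proof. exact: artin_lift1 f_braid. Qed.
Let psiV : {morph psi : a / a^-1}. Proof. exact: artin_liftV f_braid. Qed.
Let psi_gen c : psi (d_ c) = f c. Proof. exact: artin_lift_gen f_braid c. Qed.

Let psiP b a : P b a -> psi a = nfsym P1 PM PV b a.
Proof.
elim=> [|c x cb Px IH|c x cb Px IH].
- by rewrite psi1 nfsym1.
- by rewrite psiM psi_gen IH (fE cb) nfsymM //; apply: gen_by_gen.
- rewrite psiM psiV psi_gen IH (fE cb) nfsymM ?nfsymV //.
    exact: gen_by_gen.
  by apply: PV; apply: gen_by_gen.
Qed.

Let psi_prod l l' b : reduced P b (l ++ l') -> psi (\prod_(t <- l) t) l' = l ++ l'.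
Proof.
elim: l b => [|t l IHl] b; first by rewrite big_nil psi1.
move=> rl; have [Pt _ _ rl'] := rl.
by rewrite big_cons psiM symgME (IHl _ rl') (psiP Pt); apply: nfsym_cons.
Qed.

Let psi_nform a : nform P (psi a [::]) /\
  amal P ((\prod_(t <- psi a [::]) t)^-1 * a).
Proof.
have stepP b x c : P b x -> nform P (psi c [::]) /\
    amal P ((\prod_(t <- psi c [::]) t)^-1 * c) ->
    nform P (psi (x * c) [::]) /\
    amal P ((\prod_(t <- psi (x * c) [::]) t)^-1 * (x * c)).
  move=> Px [IH1 IH2]; rewrite psiM symgME (psiP Px).
  have [h1 h2] := nfsym_prod P1 PM PV Px IH1; split=> //.
  have := amalM PM h2 IH2; rewrite -!mulgA mulVKg; apply.
have sideP c : exists b, c != ii (~~ b).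
  by have [->|nc] := eqVneq c i0; [exists true | exists false].
elim/pres_ind: a => [|c a IH|c a IH].
- rewrite psi1 big_nil invg1 mul1g; split; last exact: amal1.
  by exists true.
- by have [b cb] := sideP c; apply: (@stepP b) IH; apply: gen_by_gen.
- by have [b cb] := sideP c; apply: (@stepP b) IH; apply: PV; apply: gen_by_gen.
Qed.

(** Both sides of the equation for [ii b] act on the empty list; the results are compared by length
    and by the side of the first letter. *)
Lemma infinite_pair_center (w : S -> S) a :
  (forall b, a * d_ (w (ii b)) = d_ (ii b) * a) ->
  (forall b, w (ii b) != i0 /\ w (ii b) != i1) \/
    (exists e, forall b, w (ii b) = ii (e (+) b)) ->
  gen_by d_ (fun c => c != i0) a /\ w i0 = i0.
Proof.
move=> aw wi; have [[h rl] Ca] := psi_nform a; set l := psi a [::] in rl Ca.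
have psiD b : psi (d_ (ii b)) = nfsym P1 PM PV b (d_ (ii b)).
  by apply: psiP; case: (Pii b).
have psiaw b : psi (a * d_ (w (ii b))) [::] = psi (d_ (ii b)) l.
  by rewrite aw psiM.
case: wi => [wi|[e wi]].
  (* If [w] leaves the pair, the left side keeps the length of [l], as [d_ (w (ii (~~ h)))] lies in
     [C]; on the right a letter of side [~~ h] is prepended. *)
  have := psiaw (~~ h); rewrite psiM symgME psiD.
  have Cw : amal P (d_ (w (ii (~~ h)))).
    by move=> b; apply: gen_by_gen; case: (wi (~~ h)); case: b.
  rewrite (psiP (Cw true)) nfsymE //; last by exists true.
  rewrite nfact_amal //=; last by exists true.
  have [Ph nPh] := Pii (~~ h); rewrite -[h]negbK in rl.
  have [_ s] := nfsym_new P1 PM PV Ph nPh rl.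
  by move=> /(congr1 size)/eqP; rewrite s -/l eqn_leq ltnn andbF.
have [l0|nl0] := eqVneq l [::].
  rewrite l0 big_nil invg1 mul1g in Ca; split; first exact: (Ca false).
  suff e0 : e = false by have := wi true; rewrite e0.
  have := psiaw true; rewrite psiD l0 wi.
  rewrite psiM symgME (psiP (Ca true)) psiD -psiD.
  have [Px nPx] := Pii (e (+) true).
  have nil_red b : reduced P b [::] by [].
  have [r1 s1] := nfsym_new P1 PM PV (Pii true).1 (Pii true).2 (nil_red _).
  have [r2 s2] := nfsym_new P1 PM PV Px nPx (nil_red _).
  move=> E; have r2' : reduced P (e (+) true) (psi a (psi (d_ (ii (e (+) true))) [::])).
    rewrite (psiP (Ca true)) nfsymE //; last by eexists; rewrite psiD; exact: r2.
    rewrite nfact_amal //; last by eexists; rewrite psiD; exact: r2.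
    by apply: amal_act_reduced => //; rewrite psiD.
  rewrite (psiP (Ca true)) E in r2'.
  have ne : nfsym P1 PM PV true (d_ (ii true)) [::] != [::] by rewrite -size_eq0 s1.
  by have := reduced_uniq ne r1 r2'; case: (e).
have [t Ht] := reduced_last rl nl0.
(* With this [b], the generator of [w (ii b)] lies on the side opposite to the last letter of [l]:
   on the left [l] gains a final letter, on the right either it does not grow or its first letter
   changes side. *)
pose b := e (+) ~~ t; have eb : e (+) b = ~~ t by rewrite /b addbA addbb.
have [Px nPx] := Pii (~~ t).
exfalso; have := psiaw b; rewrite wi eb.
pose c := (\prod_(t <- l) t)^-1 * a.
have -> : a * d_ (ii (~~ t)) = \prod_(t <- l) t * (c * d_ (ii (~~ t))).
  by rewrite mulgA mulVKg.
have Pcx : P (~~ t) (c * d_ (ii (~~ t))) by apply: PM => //; apply: Ca.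
have nPcx : ~ P (~~ ~~ t) (c * d_ (ii (~~ t))).
  by move=> hh; apply: nPx; rewrite -(mulKg c (d_ _)); apply: PM hh; apply: PV; apply: Ca.
have [] := nfsym_new P1 PM PV Pcx nPcx (I : reduced P _ [::]).
rewrite psiM symgME (psiP Pcx).
case: (nfsym _ _ _ _ _ [::]) => [|y [|y' l']] // /Ht rly _.
rewrite (psi_prod rly) psiD => E; have [Pb nPb] := Pii b.
have [hb|hb] : h = b \/ h = ~~ b by case: (h) (b) => -[]; auto.
  rewrite hb in rl; have := nfsym_old P1 PM PV Pb rl nl0.
  by rewrite -E size_cat /= addn1 ltnn.
rewrite hb in rl rly; have [rE sE] := nfsym_new P1 PM PV Pb nPb rl.
rewrite -E in rE; have := reduced_uniq _ rE rly.
by rewrite -size_eq0 size_cat addn1 => /(_ isT); case: (b).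
Qed.

End InfinitePair.

Lemma gen_by_support (X : choiceType) (G : groupType) (f : X -> G) Y a :
  gen_by f Y a -> exists s : seq X, gen_by f (fun c => c \in s) a.
Proof.
elim=> [|c b _ _ [s IH]|c b _ _ [s IH]]; first by exists [::]; apply: gen_by1.
- exists (c :: s); apply: gen_byS; first by rewrite inE eqxx.
  by apply: gen_by_sub IH => x xs; rewrite inE xs orbT.
- exists (c :: s); apply: gen_bySV; first by rewrite inE eqxx.
  by apply: gen_by_sub IH => x xs; rewrite inE xs orbT.
Qed.

(** Only finitely many letters occur in [a], and [parabolicI] removes them one at a time. *)
Lemma parabolic_bigI (S : countType) (m : coxeterMatrix S) (a : artin m) :
  (forall i, gen_by (artin_gen m) (fun c => c != i) a) -> a = 1.
Proof.
move=> ai; have [s] := gen_by_support (pres_gen_by a).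
elim: s => [|i s IHs] ga.
  by case: ga => // c b.
apply: IHs; apply: gen_by_sub (parabolicI (ai i) ga) => c [].
by rewrite inE => /orP[/eqP->|//]; rewrite eqxx.
Qed.

(** As [w] commutes with [opp], it maps each pair [i], [opp i] either onto itself or entirely
    outside itself. *)
Theorem artin_twisted_centralizer (S : countType) (m : coxeterMatrix S)
    (opp w : S -> S) (a : artin m) :
  involutive opp -> (forall i, opp i != i) -> (forall i, m i (opp i) = None) ->
  (forall i, w (opp i) = opp (w i)) ->
  (forall i, a * artin_gen m (w i) = artin_gen m i * a) ->
  (forall i, w i = i) /\ a = 1.
Proof.
move=> oppK oppN mopp wopp aw.
suff h i : gen_by (artin_gen m) (fun c => c != i) a /\ w i = i.
  by split=> [i|]; [case: (h i) | apply: parabolic_bigI => i; case: (h i)].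
apply: (@infinite_pair_center _ _ i (opp i)) => //; first by rewrite eq_sym.
have [wi|nwi] := eqVneq (w i) i.
  by right; exists false => -[]; rewrite //= wopp wi.
have [wi'|nwi'] := eqVneq (w i) (opp i).
  by right; exists true => -[]; rewrite //= wopp wi' oppK.
left=> -[] //=; rewrite wopp; split; last by rewrite (inj_eq (can_inj oppK)).
by rewrite -[X in _ != X]oppK (inj_eq (can_inj oppK)).
Qed.

(** * Virtual Artin groups *)

Section VirtualRoots.
Variables (S : countType) (m : coxeterMatrix S).
Notation W := (coxeter_group m).
Notation VA := (virtual_artin m).
Notation s_ := (cox_gen m).

Lemma tau_sq s : tau m s * tau m s = 1.
Proof.
have := pres_relE (VA2_square m s).
by rewrite !eval_posword_cons !eval_posword_nil mulg1.
Qed.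

Lemma tau_braid s t k : s != t -> m s t = Some k ->
  altprod (tau m s) (tau m t) k = altprod (tau m t) (tau m s) k.
Proof.
move=> nst mst; have := pres_relE (VA2_braid nst mst).
by rewrite !eval_altwordE.
Qed.

Lemma sigma_braid s t k : s != t -> m s t = Some k ->
  altprod (sigma m s) (sigma m t) k = altprod (sigma m t) (sigma m s) k.
Proof.
move=> nst mst; have := pres_relE (VA1 nst mst).
by rewrite !eval_altwordE.
Qed.

Lemma sigma_tau s t k : s != t -> m s t = Some k ->
  altprod (tau m s) (tau m t) k.-1 * sigma m t =
  sigma m (if odd k then s else t) * altprod (tau m s) (tau m t) k.-1.
Proof.
move=> nst mst; have := pres_relE (VA3 nst mst).
by rewrite eval_posword_rcons eval_posword_cons eval_altwordE.
Qed.

Lemma tau_pow s t k : s != t -> m s t = Some k -> (tau m s * tau m t) ^+ k = 1.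
Proof. by move=> nst mst; apply/altprodP; [exact: tau_sq..|exact: tau_braid]. Qed.

Definition iotaW : W -> VA := cox_lift (tau m).

Lemma iotaWM : {morph iotaW : v w / v * w}.
Proof. exact: cox_liftM tau_sq tau_pow. Qed.
Lemma iotaW1 : iotaW 1 = 1. Proof. by case: (morphV1 iotaWM). Qed.
Lemma iotaW_gen s : iotaW (s_ s) = tau m s.
Proof. exact: cox_lift_gen tau_sq tau_pow s. Qed.

Let ambient := (VA * (W * bool))%type.

Definition amb_act (w : W) (p : ambient) : ambient :=
  (iotaW w * p.1 * (iotaW w)^-1, root_rep w p.2).

Lemma amb_actM v w p : amb_act (v * w) p = amb_act v (amb_act w p).
Proof.
by rewrite /amb_act iotaWM root_repM invgM /= !mulgA.
Qed.

Lemma amb_act1 p : amb_act 1 p = p.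
Proof. by case: p => g r; rewrite /amb_act iotaW1 root_rep1 mul1g invg1 mulg1. Qed.

Definition amb_base s : ambient := (sigma m s, (s_ s, false)).

Definition is_vroot (p : ambient) : bool :=
  `[< exists w s, p = amb_act w (amb_base s) >].

(* Pairing [w sigma_s w^-1] with the root [w alpha_s] provides both an element
   of [KVA] and a sign without having to know that either determines the
   other. *)
Definition vroot := {p : ambient | is_vroot p}.

(** Coxeter matrices are indexed by countable types, so virtual roots are encoded by words for their
    components. *)
Definition va_code (g : VA) : seq ((S + S) * bool) := repr g.
Definition cox_code (w : W) : seq (S * bool) := repr w.
Definition vroot_code (b : vroot) :=
  (va_code (val b).1, (cox_code (val b).2.1, (val b).2.2)).
Definition vroot_decode
    (c : seq ((S + S) * bool) * (seq (S * bool) * bool)) : option vroot :=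
  insub ((\pi_(pres_group (@va_rel S m)) c.1)%qT,
         ((\pi_(pres_group (coxeter_rel m)) c.2.1)%qT, c.2.2)).

Lemma vroot_codeK : pcancel vroot_code vroot_decode.
Proof.
move=> [[g [r e]] h]; rewrite /vroot_code /vroot_decode /=.
by rewrite /va_code /cox_code !reprK insubT.
Qed.

End VirtualRoots.

HB.instance Definition _ (S : countType) (m : coxeterMatrix S) :=
  Choice.on (vroot m).
HB.instance Definition _ (S : countType) (m : coxeterMatrix S) :=
  PCanIsCountable (@vroot_codeK S m).

(** * The Artin group on the virtual roots and its map to the virtual Artin group *)

Section KVACentralizer.
Variables (S : countType) (m : coxeterMatrix S).
Notation W := (coxeter_group m).
Notation VA := (virtual_artin m).
Notation s_ := (cox_gen m).
Notation vroot := (vroot m).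

Fact vact_subproof (w : W) (b : vroot) : is_vroot (amb_act w (val b)).
Proof.
have /asboolP[v [s ->]] := valP b; apply/asboolP; exists (w * v), s.
by rewrite amb_actM.
Qed.

Definition vact w b : vroot := Sub (amb_act w (val b)) (vact_subproof w b).

Fact vbase_subproof s : is_vroot (amb_base m s).
Proof. by apply/asboolP; exists 1, s; rewrite amb_act1. Qed.

Definition vbase s : vroot := Sub (amb_base m s) (vbase_subproof s).

Lemma vactM v w b : vact (v * w) b = vact v (vact w b).
Proof. by apply: val_inj; rewrite /= amb_actM. Qed.

Lemma vact1 b : vact 1 b = b.
Proof. by apply: val_inj; rewrite /= amb_act1. Qed.

Lemma vact_inj w : injective (vact w).
Proof. by move=> b c /(congr1 (vact w^-1)); rewrite -!vactM mulVg !vact1. Qed.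

Lemma vrootP (b : vroot) : exists w s, b = vact w (vbase s).
Proof.
by have /asboolP[w [s E]] := valP b; exists w, s; apply: val_inj.
Qed.

Local Notation iotaW := (@iotaW S m).
Definition elt (b : vroot) : VA := (val b).1.
Definition vrefl (b : vroot) : W := (val b).2.1.

Lemma elt_act w b : elt (vact w b) = iotaW w * elt b * (iotaW w)^-1.
Proof. by []. Qed.

Lemma vrefl_act w b : vrefl (vact w b) = w * vrefl b * w^-1.
Proof. by rewrite /vrefl /=; case: (val b).2 => r e; rewrite root_repE. Qed.

Lemma vrefl_base s : vrefl (vbase s) = s_ s. Proof. by []. Qed.

Lemma vact_base_sign w s : (val (vact w (vbase s))).2.2 = rsign w (s_ s).
Proof. by []. Qed.

(** The first change of sign would give a braid relation of length less than [k] between [s_ s] and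
    [s_ t]. *)
Lemma rsign_altprod s t k p : s != t -> m s t = Some k -> p < k ->
  rsign (altprod (s_ s) (s_ t) p) (s_ t) = false.
Proof.
move=> nst mst; elim: p => [|p IHp] pk; first exact: rsign1.
rewrite altprodSl rsignM IHp /=; last exact: ltnW.
rewrite -fun_if rsign_gen; apply/negP => /eqP E.
have : altprod (s_ s) (s_ t) p.+1 = altprod (s_ t) (s_ s) p.+1.
  by rewrite altprodSl -fun_if -E mulgVK.
move/altprodP => /(_ (cox_gen_sq _ _) (cox_gen_sq _ _)).
move/(cox_gen_order nst (ltn0Sn p)) => [k']; rewrite mst => -[<-].
by move/(dvdn_leq (ltn0Sn p)); rewrite leqNgt pk.
Qed.

(** In the component in [VA] this is relation [VA3]; in the root component it is the braid relation
    of [W] together with positivity. *)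
Lemma vact_VA3 s t k : s != t -> m s t = Some k ->
  vact (altprod (s_ s) (s_ t) k.-1) (vbase t) = vbase (if odd k then s else t).
Proof.
move=> nst mst; have k2 := cox_offdiag nst mst.
apply: val_inj; rewrite /= /amb_act /amb_base /=; congr pair.
  rewrite (altprod_morph _ _ _ (@iotaWM _ m)) !iotaW_gen sigma_tau //.
  by rewrite mulgK.
rewrite root_repE (rsign_altprod nst mst) ?prednK //; last exact: ltnW.
congr pair; have := cox_gen_braid nst mst.
case: k k2 mst => // k k2 mst; rewrite altprodSl [altprod (s_ t) _ _]/= => <-.
by rewrite mulgK /=; case: (odd k).
Qed.

Definition vpair (b c : vroot) k := exists w s t,
  [/\ s != t, m s t = Some k, b = vact w (vbase s) & c = vact w (vbase t)].

Lemma vpair_uniq b c k k' : vpair b c k -> vpair b c k' -> k = k'.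
Proof.
move=> [w [s [t [nst mst -> ->]]]] [w' [s' [t' [_ mst' E1 E2]]]].
have := congr1 vrefl E1; have := congr1 vrefl E2; rewrite !vrefl_act !vrefl_base.
have key x x' : w * s_ x * w^-1 = w' * s_ x' * w'^-1 ->
    (w'^-1 * w) * s_ x * (w'^-1 * w)^-1 = s_ x'.
  by move=> E; rewrite invgM invgK mulgA -2!(mulgA w'^-1) E !mulgA mulVg mul1g mulgVK.
move=> /key Et /key Es.
by have [_] := cox_conj_order Es Et nst mst; rewrite mst' => -[].
Qed.

Lemma vpair_sym b c k : vpair b c k -> vpair c b k.
Proof.
move=> [w [s [t [nst mst -> ->]]]]; exists w, t, s.
by split; rewrite // 1?eq_sym // cox_sym.
Qed.

Lemma vpair_refl_neq b c k : vpair b c k -> vrefl b <> vrefl c.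
Proof.
move=> [w [s [t [nst mst -> ->]]]]; rewrite !vrefl_act => /mulIg/mulgI E.
by move: nst; rewrite (cox_gen_inj E) eqxx.
Qed.

Lemma vpair_act w b c k : vpair b c k -> vpair (vact w b) (vact w c) k.
Proof.
by move=> [v [s [t [nst mst -> ->]]]]; exists (w * v), s, t; rewrite !vactM.
Qed.

(** Off the diagonal, the entry is infinite unless one [w] carries two simple roots with finite
    entry to [b] and [c]. *)
Definition vmat (b c : vroot) : option nat :=
  if b == c then Some 1%N else
  if pselect (exists k, vpair b c k) is left h then Some (projT1 (cid h)) else None.

Lemma vmat_Some b c k : b != c -> vmat b c = Some k <-> vpair b c k.
Proof.
rewrite /vmat => /negbTE->; case: pselect => [h|nh]; last first.
  by split=> // h; case: nh; exists k.
case: (cid h) => k' hk' /=; split=> [[<-] //|hk].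
by rewrite (vpair_uniq hk hk').
Qed.

Lemma vpair_neq b c k : vpair b c k -> b != c.
Proof. by move/vpair_refl_neq=> h; apply/eqP => E; apply: h; rewrite E. Qed.

Fact vmat_diag b : vmat b b = Some 1%N.
Proof. by rewrite /vmat eqxx. Qed.

Fact vmat_sym b c : vmat b c = vmat c b.
Proof.
have [->//|nbc] := eqVneq b c.
have ncb : c != b by rewrite eq_sym.
case e: (vmat b c) => [k|].
  by apply/esym/(vmat_Some _ ncb)/vpair_sym/(vmat_Some _ nbc).
case e': (vmat c b) => [k|//].
by move/(vmat_Some _ ncb)/vpair_sym/(vmat_Some _ nbc): e'; rewrite e.
Qed.

Fact vmat_offdiag b c k : b != c -> vmat b c = Some k -> 2 <= k.
Proof.
move=> nbc /(vmat_Some _ nbc)[w [s [t [nst mst _ _]]]].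
exact: cox_offdiag nst mst.
Qed.

Definition vcox := CoxeterMatrix vmat_diag vmat_sym vmat_offdiag.
Notation A := (artin vcox).
Notation d_ := (artin_gen vcox).

Lemma d_braid b c k : vpair b c k -> altprod (d_ b) (d_ c) k = altprod (d_ c) (d_ b) k.
Proof.
by move=> h; have n := vpair_neq h; apply: artin_gen_braid => //; apply/vmat_Some.
Qed.

Definition theta : A -> VA := artin_lift elt.

Lemma theta_braid b c k : b != c -> vcox b c = Some k ->
  altprod (elt b) (elt c) k = altprod (elt c) (elt b) k.
Proof.
move=> nbc /(vmat_Some _ nbc)[w [s [t [nst mst -> ->]]]].
pose conj (x : VA) := iotaW w * x * (iotaW w)^-1.
have conjM : {morph conj : x y / x * y} by move=> x y; rewrite /conj !mulgA mulgVK.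
rewrite !elt_act -!/(conj _) -!(altprod_morph _ _ _ conjM).
by rewrite /elt /= sigma_braid.
Qed.

Lemma thetaM : {morph theta : a b / a * b}.
Proof. exact: artin_liftM theta_braid. Qed.
Lemma theta1 : theta 1 = 1. Proof. exact: artin_lift1 theta_braid. Qed.
Lemma thetaV : {morph theta : a / a^-1}. Proof. exact: artin_liftV theta_braid. Qed.
Lemma theta_gen b : theta (d_ b) = elt b.
Proof. exact: artin_lift_gen theta_braid b. Qed.

Definition aact (w : W) : A -> A :=
  @artin_lift _ vcox _ (fun b => d_ (vact w b)).

Lemma aact_braid w b c k : b != c -> vcox b c = Some k ->
  altprod (d_ (vact w b)) (d_ (vact w c)) k = altprod (d_ (vact w c)) (d_ (vact w b)) k.
Proof. by move=> nbc /(vmat_Some _ nbc)/(vpair_act w)/d_braid. Qed.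

Lemma aactM w : {morph aact w : a b / a * b}.
Proof. exact: artin_liftM (@aact_braid w). Qed.
Lemma aact1r w : aact w 1 = 1. Proof. exact: artin_lift1 (@aact_braid w). Qed.
Lemma aactV w : {morph aact w : a / a^-1}. Proof. exact: artin_liftV (@aact_braid w). Qed.
Lemma aact_gen w b : aact w (d_ b) = d_ (vact w b).
Proof. exact: artin_lift_gen (@aact_braid w) b. Qed.

Lemma aact_mul v w a : aact (v * w) a = aact v (aact w a).
Proof.
elim/pres_ind: a => [|b a IH|b a IH]; first by rewrite !aact1r.
  by rewrite !aactM IH !aact_gen vactM.
by rewrite !aactM IH !aactV !aact_gen vactM.
Qed.

Lemma aact_id a : aact 1 a = a.
Proof.
elim/pres_ind: a => [|b a IH|b a IH]; first by rewrite !aact1r.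
  by rewrite !aactM IH !aact_gen vact1.
by rewrite !aactM IH !aactV !aact_gen vact1.
Qed.

Lemma theta_aact w a : theta (aact w a) = iotaW w * theta a * (iotaW w)^-1.
Proof.
elim/pres_ind: a => [|b a IH|b a IH].
- by rewrite aact1r theta1 mulg1 mulgV.
- by rewrite aactM !thetaM IH aact_gen !theta_gen elt_act !mulgA mulgVK.
- rewrite aactM !thetaM IH aactV aact_gen !thetaV !theta_gen elt_act.
  by rewrite !invgM invgK !mulgA mulgVK.
Qed.

Lemma theta_iota g : exists a w, g = theta a * iotaW w.
Proof.
have tauV s : (tau m s)^-1 = tau m s by apply/invol_inv/tau_sq.
have eltE s : elt (vbase s) = sigma m s by [].
elim/pres_ind: g => [|[s|s] g [a [w ->]]|[s|s] g [a [w ->]]].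
- by exists 1, 1; rewrite theta1 iotaW1 mulg1.
- by exists (d_ (vbase s) * a), w; rewrite thetaM theta_gen eltE mulgA.
- exists (aact (s_ s) a), (s_ s * w).
  by rewrite theta_aact iotaWM iotaW_gen !mulgA mulgVK.
- by exists ((d_ (vbase s))^-1 * a), w; rewrite thetaM thetaV theta_gen eltE mulgA.
- exists (aact (s_ s) a), (s_ s * w).
  rewrite theta_aact iotaWM iotaW_gen !mulgA mulgVK.
  by rewrite -[X in X * _ * _]/((tau m s)^-1) tauV.
Qed.

(** * The action of the virtual Artin group on the set of the semidirect product *)

Let AW := (A * W)%type.

Fact lmulK (x : A) : cancel (fun p : AW => (x * p.1, p.2)) (fun p => (x^-1 * p.1, p.2)).
Proof. by case=> a w; rewrite /= mulKg. Qed.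
Fact lmulVK (x : A) : cancel (fun p : AW => (x^-1 * p.1, p.2)) (fun p => (x * p.1, p.2)).
Proof. by case=> a w; rewrite /= mulVKg. Qed.
Definition lmul x := Symg (lmulK x) (lmulVK x).

Fact tactK (v : W) :
  cancel (fun p : AW => (aact v p.1, v * p.2)) (fun p => (aact v^-1 p.1, v^-1 * p.2)).
Proof. by case=> a w; rewrite /= mulKg -aact_mul mulVg aact_id. Qed.
Fact tactVK (v : W) :
  cancel (fun p : AW => (aact v^-1 p.1, v^-1 * p.2)) (fun p => (aact v p.1, v * p.2)).
Proof. by case=> a w; rewrite /= mulVKg -aact_mul mulgV aact_id. Qed.
Definition tact v := Symg (tactK v) (tactVK v).

Lemma lmulM : {morph lmul : x y / x * y}.
Proof. by move=> x y; apply: symg_ext => -[a w]; rewrite /= mulgA. Qed.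

Lemma tactM : {morph tact : v w / v * w}.
Proof. by move=> v w; apply: symg_ext => -[a u]; rewrite /= aact_mul mulgA. Qed.

Lemma tact_lmul v x : tact v * lmul x = lmul (aact v x) * tact v.
Proof. by apply: symg_ext => -[a w]; rewrite /= aactM. Qed.

Definition va_act_gen (x : va_gen S) : symg AW :=
  match x with inl s => lmul (d_ (vbase s)) | inr s => tact (s_ s) end.

Lemma va_act_rel u v : va_rel m u v -> eval_word va_act_gen u = eval_word va_act_gen v.
Proof.
case=> [s t k nst mst|s t k nst mst|s|s t k nst mst P r].
- rewrite !eval_altwordE /= -!(altprod_morph _ _ _ lmulM) d_braid //.
  by exists 1, s, t; rewrite !vact1.
- by rewrite !eval_altwordE /= -!(altprod_morph _ _ _ tactM) (cox_gen_braid nst mst).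
- rewrite !eval_posword_cons !eval_posword_nil mulg1 /= -tactM cox_gen_sq.
  by case: (morphV1 tactM).
- rewrite eval_posword_rcons eval_posword_cons eval_altwordE /=.
  rewrite -(altprod_morph _ _ _ tactM) tact_lmul aact_gen vact_VA3 //.
Qed.

Definition va_act : VA -> symg AW := @pres_lift _ (va_rel m) _ va_act_gen.

Lemma va_actM : {morph va_act : g h / g * h}.
Proof. exact: pres_liftM va_act_rel. Qed.

Lemma va_act_iota w : va_act (iotaW w) = tact w.
Proof.
elim/cox_ind: w => [|s w IHw].
  by rewrite iotaW1 (morphV1 va_actM).1 (morphV1 tactM).1.
rewrite iotaWM va_actM IHw iotaW_gen tactM; congr (_ * _).
exact: (pres_lift_gen va_act_rel).
Qed.

Lemma va_act_elt b : va_act (elt b) = lmul (d_ b).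
Proof.
have [w [s ->]] := vrootP b; rewrite elt_act !va_actM (morphV1 va_actM).2 va_act_iota.
have -> : va_act (elt (vbase s)) = lmul (d_ (vbase s)).
  exact: (pres_lift_gen va_act_rel).
by rewrite tact_lmul aact_gen mulgK.
Qed.

Lemma va_act_theta a : va_act (theta a) = lmul a.
Proof.
elim/pres_ind: a => [|b a IH|b a IH].
- by rewrite theta1 (morphV1 va_actM).1 (morphV1 lmulM).1.
- by rewrite thetaM va_actM IH theta_gen va_act_elt lmulM.
- rewrite thetaM va_actM IH thetaV theta_gen (morphV1 va_actM).2 va_act_elt.
  by rewrite lmulM (morphV1 lmulM).2.
Qed.

(** The permutation [va_act (theta a)] sends [(1, 1)] to [(a, 1)]. *)
Lemma theta_inj : injective theta.
Proof.
move=> a b /(congr1 va_act); rewrite !va_act_theta.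
by move/(congr1 (fun f : symg AW => (f (1, 1)).1)); rewrite /= !mulg1.
Qed.

Lemma elt_KVA b : KVA m (elt b).
Proof.
have pM : {morph piK m : x y / x * y} := pres_liftM (@piK_gen_rel S m).
have [w [s ->]] := vrootP b; rewrite /KVA /= elt_act !pM (morphV1 pM).2.
by rewrite [piK m (elt _)]piK_sigma mulg1 mulgV.
Qed.

(** The opposite root, as the image of [b] under its own reflection. *)
Definition vopp b := vact (vrefl b) b.

Lemma vopp_act w b : vopp (vact w b) = vact w (vopp b).
Proof. by rewrite /vopp vrefl_act -!vactM mulgVK. Qed.

Lemma vrefl_opp b : vrefl (vopp b) = vrefl b.
Proof. by rewrite vrefl_act mulgK. Qed.

Lemma vrefl_sq b : vrefl b * vrefl b = 1.
Proof.
have [w [s ->]] := vrootP b; rewrite vrefl_act vrefl_base !mulgA mulgVK.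
by rewrite -(mulgA w) cox_gen_sq mulg1 mulgV.
Qed.

Lemma voppK : involutive vopp.
Proof. by move=> b; rewrite {1}/vopp vrefl_opp /vopp -vactM vrefl_sq vact1. Qed.

Lemma vopp_neq b : vopp b != b.
Proof.
have [w [s ->]] := vrootP b; rewrite vopp_act (inj_eq (@vact_inj w)).
apply/eqP => /(congr1 (fun b : vroot => (val b).2.2)).
by rewrite /vopp vact_base_sign rsign_gen eqxx.
Qed.

(** Opposite roots have the same reflection, while distinct roots with a finite entry have different
    ones. *)
Lemma vcox_opp b : vcox b (vopp b) = None.
Proof.
case e: (vcox b _) => [k|//]; have n : b != vopp b by rewrite eq_sym vopp_neq.
by case/(vmat_Some _ n)/vpair_refl_neq: e; rewrite vrefl_opp.
Qed.

Lemma centralizer_KVA_trivial g : centralizer (KVA m) g -> g = 1.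
Proof.
move=> gc; have [a [w Eg]] := theta_iota g.
(* Moving [elt b] across [iotaW w] turns the commutation into an equation in the image of
   [theta]. *)
have aw b : a * d_ (vact w b) = d_ b * a.
  apply: theta_inj; rewrite !thetaM !theta_gen elt_act.
  have := gc _ (elt_KVA b); rewrite /commute Eg => E.
  by rewrite !mulgA E -!mulgA mulgV mulg1.
have [wid a1] := artin_twisted_centralizer voppK vopp_neq vcox_opp
  (fun b => esym (vopp_act w b)) aw.
(* A nontrivial [w] would make some simple root negative, but [w] fixes all roots. *)
rewrite Eg a1 theta1 mul1g; have [->|/cox_neq1_neg[s]] := eqVneq w 1.
  exact: iotaW1.
by rewrite -vact_base_sign wid.
Qed.

End KVACentralizer.

Local Open Scope classical_set_scope.

Theorem theorem4p4 (S : countType) (m : coxeterMatrix S) :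
  cox_connected m -> centralizer (KVA m) = [set 1%g].
Proof.
move=> _; apply/seteqP; split=> g /= => [/centralizer_KVA_trivial //|->].
by move=> e _; apply/commute_sym/commute1.
Qed.
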